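(* Let $\mathcal{E}$ be an elementary topos equipped with an interval object $\mathbb{I}$ with connections and a class $\mathcal{C}$ of monomorphisms satisfying the axioms described in the context. Let $\mathcal{E}_f$ be the full subcategory of $\mathcal{E}$ on the fibrant objects. Then $\mathcal{E}_f$ carries a Quillen model structure whose cofibrations are the morphisms of $\mathcal{E}_f$ belonging to $\mathcal{C}$, whose fibrations are the morphisms of $\mathcal{E}_f$ that are fibrations in the sense below, and whose weak equivalences are the homotopy equivalences.
   Context: Setting: $\mathcal{E}$ is an elementary topos. $\mathbb{I}$ is an object with a monomorphism $[\partial_0,\partial_1]:1+1\to\mathbb{I}$ and maps (''connections'') $\land,\lor:\mathbb{I}\times\mathbb{I}\to\mathbb{I}$ satisfying $i\land 0=0\land i=0$, $i\land 1=1\land i=i$, $i\lor 0=0\lor i=i$, $i\lor 1=1\lor i=1$ (writing $0,1$ for $\partial_0,\partial_1$). $\mathcal{C}$ is a class of monomorphisms (the ''cofibrations'') such that: (a) $\mathcal{C}$ is a dominance, i.e. contains all isomorphisms, is closed under composition and under pullback, and the category of maps in $\mathcal{C}$ with pullback squares between them has a terminal object (equivalently $\mathcal{C}$ is the class of monos classified by a subobject $\Sigma\subseteq\Omega$ with $\top\in\Sigma$ and $p\in\Sigma\wedge(p\Rightarrow q\in\Sigma)\Rightarrow p\wedge q\in\Sigma$); (b) $\mathcal{C}$ is closed under finite unions (all maps $0\to X$ are in $\mathcal{C}$ and the union of two $\mathcal{C}$-subobjects is a $\mathcal{C}$-subobject); (c) $[\partial_0,\partial_1]\in\mathcal{C}$.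 For $f:A\to B$, $g:C\to D$, the Leibniz product $f\hat\otimes g:(B\times C)\cup_{A\times C}(A\times D)\to B\times D$ is the map induced from the pushout of $f\times 1$ and $1\times g$. A map has the right lifting property (RLP) against $u$ if every commutative square from $u$ to it has a diagonal filler. A trivial fibration is a map with the RLP against all maps in $\mathcal{C}$. A fibration is a map with the RLP against all maps $\partial_i\hat\otimes u$ with $u\in\mathcal{C}$, $i\in\{0,1\}$ (here $\partial_i:1\to\mathbb{I}$). An object $X$ is fibrant if $X\to 1$ is a fibration. Two maps $f,g:B\to A$ are homotopic if there is $H:\mathbb{I}\times B\to A$ with $H(\partial_0\times B)=f$, $H(\partial_1\times B)=g$. A homotopy equivalence is a map $f:B\to A$ with some $g:A\to B$ such that $gf$ is homotopic to $1_B$ and $fg$ to $1_A$. *)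

(* Defs.v *)
Set Implicit Arguments.
Unset Strict Implicit.
Unset Printing Implicit Defensive.

Declare Scope topos_scope.
Delimit Scope topos_scope with topos.
Local Open Scope topos_scope.

Record Category := {
  Ob :> Type;
  Hom : Ob -> Ob -> Type;
  idm : forall X : Ob, Hom X X;
  comp : forall X Y Z : Ob, Hom Y Z -> Hom X Y -> Hom X Z;
  comp_idl : forall (X Y : Ob) (f : Hom X Y), comp (idm Y) f = f;
  comp_idr : forall (X Y : Ob) (f : Hom X Y), comp f (idm X) = f;
  comp_assoc : forall (W X Y Z : Ob) (h : Hom Y Z) (g : Hom X Y) (f : Hom W X),
    comp h (comp g f) = comp (comp h g) f
}.

Arguments Hom {c} X Y.
Arguments idm {c} X.
Arguments comp {c X Y Z} g f.

Notation "g ∘ f" := (comp g f) (at level 40, left associativity) : topos_scope.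

Definition MorClass (K : Category) : Type := forall X Y : K, Hom X Y -> Prop.

Section Notions.
Variable K : Category.

Definition monic (X Y : K) (m : Hom X Y) : Prop :=
  forall (Z : K) (f g : Hom Z X), m ∘ f = m ∘ g -> f = g.

Definition is_iso (X Y : K) (f : Hom X Y) : Prop :=
  exists g : Hom Y X, g ∘ f = idm X /\ f ∘ g = idm Y.

Definition is_initial (Z : K) : Prop :=
  forall X : K, exists! f : Hom Z X, True.

Definition is_coproduct (A B S : K) (inl : Hom A S) (inr : Hom B S) : Prop :=
  forall (X : K) (f : Hom A X) (g : Hom B X),
    exists! h : Hom S X, h ∘ inl = f /\ h ∘ inr = g.

Definition is_equalizer (Q A B : K) (f g : Hom A B) (e : Hom Q A) : Prop :=
  f ∘ e = g ∘ e /\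
  forall (Z : K) (h : Hom Z A), f ∘ h = g ∘ h -> exists! k : Hom Z Q, e ∘ k = h.

(* P -q-> B
   |p     |g
   A -f-> X  *)
Definition is_pullback (P A B X : K) (f : Hom A X) (g : Hom B X)
    (p : Hom P A) (q : Hom P B) : Prop :=
  f ∘ p = g ∘ q /\
  forall (Z : K) (a : Hom Z A) (b : Hom Z B), f ∘ a = g ∘ b ->
    exists! h : Hom Z P, p ∘ h = a /\ q ∘ h = b.

Definition is_pushout (X A B P : K) (f : Hom X A) (g : Hom X B)
    (p : Hom A P) (q : Hom B P) : Prop :=
  p ∘ f = q ∘ g /\
  forall (Z : K) (a : Hom A Z) (b : Hom B Z), a ∘ f = b ∘ g ->
    exists! h : Hom P Z, h ∘ p = a /\ h ∘ q = b.

Definition sub_le (X A B : K) (m : Hom A X) (n : Hom B X) : Prop :=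
  exists k : Hom A B, n ∘ k = m.

(* w represents the join of m and n in the poset of subobjects of X. *)
Definition is_union (X A B U : K) (m : Hom A X) (n : Hom B X) (w : Hom U X) : Prop :=
  monic w /\ sub_le m w /\ sub_le n w /\
  forall (V : K) (v : Hom V X), monic v -> sub_le m v -> sub_le n v -> sub_le w v.

(* p has the right lifting property against u. *)
Definition rlp (A B X Y : K) (u : Hom A B) (p : Hom X Y) : Prop :=
  forall (t : Hom A X) (b : Hom B Y), p ∘ t = b ∘ u ->
    exists d : Hom B X, d ∘ u = t /\ p ∘ d = b.

Definition is_retract (A B X Y : K) (f : Hom A B) (g : Hom X Y) : Prop :=
  exists (s : Hom A X) (r : Hom X A) (s' : Hom B Y) (r' : Hom Y B),
    r ∘ s = idm A /\ r' ∘ s' = idm B /\ g ∘ s = s' ∘ f /\ f ∘ r = r' ∘ g.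

Definition retract_closed (L : MorClass K) : Prop :=
  forall (A B X Y : K) (f : Hom A B) (g : Hom X Y),
    is_retract f g -> L X Y g -> L A B f.

(* Quillen's axioms for a (closed) model structure given by three classes of
   maps on a category, which is not itself required to be finitely complete or
   cocomplete. *)
Record model_structure (Cof Fib W : MorClass K) : Prop := {
  ms_two_of_three_comp : forall (X Y Z : K) (f : Hom X Y) (g : Hom Y Z),
    W _ _ f -> W _ _ g -> W _ _ (g ∘ f);
  ms_two_of_three_left : forall (X Y Z : K) (f : Hom X Y) (g : Hom Y Z),
    W _ _ f -> W _ _ (g ∘ f) -> W _ _ g;
  ms_two_of_three_right : forall (X Y Z : K) (f : Hom X Y) (g : Hom Y Z),
    W _ _ g -> W _ _ (g ∘ f) -> W _ _ f;
  ms_retract_cof : retract_closed Cof;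
  ms_retract_fib : retract_closed Fib;
  ms_retract_weq : retract_closed W;
  ms_lift_cof_tfib : forall (A B X Y : K) (u : Hom A B) (p : Hom X Y),
    Cof _ _ u -> Fib _ _ p -> W _ _ p -> rlp u p;
  ms_lift_tcof_fib : forall (A B X Y : K) (u : Hom A B) (p : Hom X Y),
    Cof _ _ u -> W _ _ u -> Fib _ _ p -> rlp u p;
  ms_factor_cof_tfib : forall (X Y : K) (f : Hom X Y),
    exists (Z : K) (u : Hom X Z) (p : Hom Z Y),
      Cof _ _ u /\ Fib _ _ p /\ W _ _ p /\ p ∘ u = f;
  ms_factor_tcof_fib : forall (X Y : K) (f : Hom X Y),
    exists (Z : K) (u : Hom X Z) (p : Hom Z Y),
      Cof _ _ u /\ W _ _ u /\ Fib _ _ p /\ p ∘ u = f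
}.

Definition full_subcategory (P : K -> Prop) : Category := {|
  Ob := {X : K | P X};
  Hom := fun X Y => Hom (proj1_sig X) (proj1_sig Y);
  idm := fun X => idm (proj1_sig X);
  comp := fun X Y Z g f => g ∘ f;
  comp_idl := fun X Y f => comp_idl f;
  comp_idr := fun X Y f => comp_idr f;
  comp_assoc := fun W X Y Z h g f => comp_assoc h g f
|}.

Definition restrict (P : K -> Prop) (L : MorClass K) : MorClass (full_subcategory P) :=
  fun X Y f => L (proj1_sig X) (proj1_sig Y) f.

End Notions.

(* An elementary topos: (chosen) finite limits, exponentials and a subobject
   classifier. Finite colimits are a consequence and are not part of the
   structure; below they are referred to by their universal properties. *)
Record Topos := {
  topos_cat :> Category;

  one : topos_cat;
  bang : forall X : topos_cat, Hom X one;
  bang_unique : forall (X : topos_cat) (f : Hom X one), f = bang X;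

  prod : topos_cat -> topos_cat -> topos_cat;
  pr1 : forall A B : topos_cat, Hom (prod A B) A;
  pr2 : forall A B : topos_cat, Hom (prod A B) B;
  pair : forall Z A B : topos_cat, Hom Z A -> Hom Z B -> Hom Z (prod A B);
  pr1_pair : forall (Z A B : topos_cat) (f : Hom Z A) (g : Hom Z B),
    pr1 A B ∘ pair f g = f;
  pr2_pair : forall (Z A B : topos_cat) (f : Hom Z A) (g : Hom Z B),
    pr2 A B ∘ pair f g = g;
  pair_unique : forall (Z A B : topos_cat) (h : Hom Z (prod A B)),
    h = pair (pr1 A B ∘ h) (pr2 A B ∘ h);

  equ : forall A B : topos_cat, Hom A B -> Hom A B -> topos_cat;
  equ_map : forall (A B : topos_cat) (f g : Hom A B), Hom (equ f g) A;
  equ_is_equalizer : forall (A B : topos_cat) (f g : Hom A B),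
    is_equalizer f g (equ_map f g);

  exp : topos_cat -> topos_cat -> topos_cat;
  ev : forall A B : topos_cat, Hom (prod (exp A B) A) B;
  exp_universal : forall (Z A B : topos_cat) (f : Hom (prod Z A) B),
    exists! h : Hom Z (exp A B), ev A B ∘ pair (h ∘ pr1 Z A) (pr2 Z A) = f;

  Omega : topos_cat;
  truth : Hom one Omega;
  classify : forall (A X : topos_cat) (m : Hom A X), monic m ->
    exists! chi : Hom X Omega, is_pullback chi truth m (bang A)
}.

Arguments one {t}.
Arguments bang {t} X.
Arguments prod {t} A B.
Arguments pr1 {t A B}.
Arguments pr2 {t A B}.
Arguments pair {t Z A B} f g.

Notation "A × B" := (prod A B) (at level 40, left associativity) : topos_scope.
Notation "⟨ f , g ⟩" := (pair f g) (at level 0, f at level 99, g at level 99) : topos_scope.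

Definition prod_map (E : Topos) (A B C D : E) (f : Hom A B) (g : Hom C D) :
    Hom (A × C) (B × D) :=
  ⟨f ∘ pr1, g ∘ pr2⟩.

(* w is the map (B × C) ∪_{A × C} (A × D) -> B × D induced out of some pushout. *)
Definition is_leibniz_product (E : Topos) (A B C D P : E)
    (f : Hom A B) (g : Hom C D) (w : Hom P (B × D)) : Prop :=
  exists (j1 : Hom (B × C) P) (j2 : Hom (A × D) P),
    is_pushout (prod_map f (idm C)) (prod_map (idm A) g) j1 j2 /\
    w ∘ j1 = prod_map (idm B) g /\
    w ∘ j2 = prod_map f (idm D).

(* two, with its two injections, is the coproduct 1 + 1. *)
Record Interval (E : Topos) := {
  two : E;
  two_inl : Hom one two;
  two_inr : Hom one two;
  two_is_coproduct : is_coproduct two_inl two_inr;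

  int :> Ob E;
  bdry : Hom two int;
  bdry_monic : monic bdry;

  meet : Hom (int × int) int;
  join : Hom (int × int) int;
  (* the endpoints as constant maps int -> int *)
  int0 := (bdry ∘ two_inl) ∘ bang int;
  int1 := (bdry ∘ two_inr) ∘ bang int;
  meet_x0 : meet ∘ ⟨idm int, int0⟩ = int0;
  meet_0x : meet ∘ ⟨int0, idm int⟩ = int0;
  meet_x1 : meet ∘ ⟨idm int, int1⟩ = idm int;
  meet_1x : meet ∘ ⟨int1, idm int⟩ = idm int;
  join_x0 : join ∘ ⟨idm int, int0⟩ = idm int;
  join_0x : join ∘ ⟨int0, idm int⟩ = idm int;
  join_x1 : join ∘ ⟨idm int, int1⟩ = int1;
  join_1x : join ∘ ⟨int1, idm int⟩ = int1
}.

(* The endpoint inclusions: false is 0, true is 1. *)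
Definition endpoint (E : Topos) (I : Interval E) (i : bool) : Hom one I :=
  bdry I ∘ (if i then two_inr I else two_inl I).

Record is_dominance (E : Topos) (C : MorClass E) : Prop := {
  dom_monic : forall (A B : E) (u : Hom A B), C _ _ u -> monic u;
  dom_iso : forall (A B : E) (u : Hom A B), is_iso u -> C _ _ u;
  dom_comp : forall (X Y Z : E) (u : Hom X Y) (v : Hom Y Z),
    C _ _ u -> C _ _ v -> C _ _ (v ∘ u);
  dom_pullback : forall (P A B X : E) (f : Hom A X) (u : Hom B X)
      (p : Hom P A) (q : Hom P B),
    is_pullback f u p q -> C _ _ u -> C _ _ p;
  (* terminal object of the category of maps in C and pullback squares *)
  dom_terminal : exists (T0 T1 : E) (t : Hom T0 T1), C _ _ t /\
    forall (A B : E) (u : Hom A B), C _ _ u ->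
      exists! ab : Hom A T0 * Hom B T1, is_pullback (snd ab) t u (fst ab)
}.

Record cofibration_class (E : Topos) (I : Interval E) (C : MorClass E) : Prop := {
  cof_dominance : is_dominance C;
  cof_initial : forall (Z X : E) (u : Hom Z X), is_initial Z -> C _ _ u;
  cof_union : forall (X A B U : E) (m : Hom A X) (n : Hom B X) (w : Hom U X),
    C _ _ m -> C _ _ n -> is_union m n w -> C _ _ w;
  cof_bdry : C _ _ (bdry I)
}.

Section Homotopy.
Variables (E : Topos) (I : Interval E).

Definition fibration (C : MorClass E) : MorClass E := fun X Y p =>
  forall (i : bool) (A B : E) (u : Hom A B) (P : E) (w : Hom P (I × B)),
    C _ _ u -> is_leibniz_product (endpoint I i) u w -> rlp w p.

Definition fibrant (C : MorClass E) (X : E) : Prop := fibration C (bang X).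

(* endpoint i × B, precomposed with the isomorphism B ≅ 1 × B *)
Definition at_end (i : bool) (B : E) : Hom B (I × B) :=
  ⟨endpoint I i ∘ bang B, idm B⟩.

Definition homotopic (B A : E) (f g : Hom B A) : Prop :=
  exists H : Hom (I × B) A, H ∘ at_end false B = f /\ H ∘ at_end true B = g.

Definition homotopy_equivalence : MorClass E := fun B A f =>
  exists g : Hom A B, homotopic (g ∘ f) (idm B) /\ homotopic (f ∘ g) (idm A).

End Homotopy.

(* Main.v *)
(** Subobjects are handled by Kripke-Joyal forcing over generalized elements.
    The union of two subobjects is defined impredicatively, which makes it stable
    under pullback and hence a pushout over the intersection; maps out of open
    boxes can then be glued.

    The model structure rests on three box-filling arguments.  A fibration which
    is a homotopy equivalence has a strict section [s] and, by filling a square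
    built with the connection [\/], a vertical homotopy [s f ~ 1], so it lifts
    against every cofibration.  Dually, a cofibration between fibrant objects
    which is a homotopy equivalence is a strong deformation retract, so it lifts
    against every fibration.  Finally [X ×_Y Y^I -> Y] is a fibration, and
    [X -> X ×_Y Y^I] is a homotopy equivalence thanks to the connection [/\].
    Cofibrations and trivial fibrations form a factorization system through the
    fibrewise classifier of partial maps with domain in [C]; combined with the
    mapping path object it yields the other factorization. *)

From Corelib Require Import ssreflect ssrbool.
From Stdlib Require Import Setoid.
Require Import Defs.

Set Implicit Arguments.
Unset Strict Implicit.
Unset Printing Implicit Defensive.
Set Bullet Behavior "None".
Local Open Scope topos_scope.

(** * Finite products in a topos *)

Section ToposTheory.
Variable E : Topos.
Implicit Types A B S T W X Y Z : E.

Lemma pair_comp Z' Z A B (f : Hom Z A) (g : Hom Z B) (h : Hom Z' Z) :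
  ⟨f, g⟩ ∘ h = ⟨f ∘ h, g ∘ h⟩.
Proof. by rewrite [LHS]pair_unique !comp_assoc pr1_pair pr2_pair. Qed.

Lemma pair_pr A B : ⟨pr1, pr2⟩ = idm (A × B).
Proof. by rewrite [RHS]pair_unique !comp_idr. Qed.

Lemma pair_pr_comp Z A B (h : Hom Z (A × B)) : ⟨pr1 ∘ h, pr2 ∘ h⟩ = h.
Proof. by rewrite -pair_unique. Qed.

Lemma pair_inj Z A B (f f' : Hom Z A) (g g' : Hom Z B) :
  ⟨f, g⟩ = ⟨f', g'⟩ -> f = f' /\ g = g'.
Proof.
move=> e; split.
- by rewrite -(pr1_pair f g) e pr1_pair.
- by rewrite -(pr2_pair f g) e pr2_pair.
Qed.

Lemma pair_ext Z A B (h k : Hom Z (A × B)) :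
  pr1 ∘ h = pr1 ∘ k -> pr2 ∘ h = pr2 ∘ k -> h = k.
Proof. by move=> e1 e2; rewrite (pair_unique h) (pair_unique k) e1 e2. Qed.

Lemma bang_comp Z X (f : Hom Z X) : bang X ∘ f = bang Z.
Proof. exact: bang_unique. Qed.

Lemma to_one_eq X (f g : Hom X (one : E)) : f = g.
Proof. by rewrite (bang_unique f) (bang_unique g). Qed.

Lemma assocr (K : Category) (W X Y Z : K) (h : Hom Y Z) (g : Hom X Y) (f : Hom W X) :
  h ∘ g ∘ f = h ∘ (g ∘ f).
Proof. by rewrite comp_assoc. Qed.

End ToposTheory.

#[global] Hint Rewrite assocr comp_idl comp_idr pair_comp pr1_pair pr2_pair
  bang_comp pair_pr pair_pr_comp : cat.

Ltac cat := rewrite /prod_map /at_end; autorewrite with cat.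

(** * Kripke-Joyal semantics and unions of subobjects *)

Section InternalLogic.
Variable E : Topos.
Implicit Types A B S T W X Y Z : E.

Lemma equ_monic X Y (f g : Hom X Y) : monic (equ_map f g).
Proof.
move=> Z a b e; case: (equ_is_equalizer f g) => ef u.
have [] := u Z (equ_map f g ∘ a).
  by rewrite comp_assoc ef -comp_assoc.
by move=> k [_ uk]; rewrite -(uk a) // -(uk b).
Qed.

Lemma equ_factor X Y (f g : Hom X Y) S (h : Hom S X) :
  f ∘ h = g ∘ h <-> exists k, equ_map f g ∘ k = h.
Proof.
case: (equ_is_equalizer f g) => ef u; split.
- by move=> e; case: (u S h e) => k [ek _]; exists k.
- by case=> k <-; rewrite !comp_assoc ef.
Qed.

Definition top X : Hom X (Omega E) := truth E ∘ bang X.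

Lemma top_comp X Y (f : Hom X Y) : top Y ∘ f = top X.
Proof. by rewrite /top -comp_assoc bang_comp. Qed.

Lemma pullback_truth A X (chi : Hom X (Omega E)) (m : Hom A X) :
  monic m ->
  (forall S (f : Hom S X), chi ∘ f = top S <-> exists g, m ∘ g = f) ->
  is_pullback chi (truth E) m (bang A).
Proof.
move=> mm H; split.
  by apply/H; exists (idm A); rewrite comp_idr.
move=> S a b e.
have [g eg] : exists g, m ∘ g = a.
  by apply/H; rewrite e /top (bang_unique b).
exists g; split; first by split => //; apply: to_one_eq.
by move=> g' [e' _]; apply: mm; rewrite eg e'.
Qed.

Lemma comprehension X (chi : Hom X (Omega E)) :
  exists W (w : Hom W X), monic w /\
    forall S (f : Hom S X), chi ∘ f = top S <-> exists g, w ∘ g = f.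
Proof.
exists (equ chi (top X)), (equ_map chi (top X)); split; first exact: equ_monic.
by move=> S f; rewrite -equ_factor top_comp.
Qed.

Lemma char_of_monic A X (m : Hom A X) : monic m ->
  exists chi : Hom X (Omega E),
    forall S (f : Hom S X), chi ∘ f = top S <-> exists g, m ∘ g = f.
Proof.
move=> mm; case: (classify mm) => chi [[e u] _]; exists chi => S f; split.
- move=> ef; case: (u S f (bang S)) => // g [[eg _] _]; by exists g.
- by case=> g <-; rewrite comp_assoc e /top -comp_assoc bang_comp.
Qed.

(** Both maps classify the subobject [w] cut out by [chi], and classifying maps are unique. *)
Lemma Omega_ext X (chi psi : Hom X (Omega E)) :
  (forall S (f : Hom S X), chi ∘ f = top S <-> psi ∘ f = top S) -> chi = psi.
Proof.
move=> H; case: (comprehension chi) => W [w [mw Hw]].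
case: (classify mw) => phi [_ u].
rewrite -(u chi) ?(u psi) //; apply: pullback_truth => // S f.
by rewrite -H.
Qed.

Lemma curry Z A B (f : Hom (Z × A) B) :
  exists h : Hom Z (exp A B), forall S (z : Hom S Z) (a : Hom S A),
    ev A B ∘ ⟨h ∘ z, a⟩ = f ∘ ⟨z, a⟩.
Proof.
case: (exp_universal f) => h [<- _]; exists h => S z a; by cat.
Qed.

Lemma curry_inj Z A B (h k : Hom Z (exp A B)) :
  ev A B ∘ ⟨h ∘ pr1, pr2⟩ = ev A B ∘ ⟨k ∘ pr1, pr2⟩ -> h = k.
Proof.
move=> e; case: (exp_universal (ev A B ∘ ⟨h ∘ pr1, pr2⟩)) => l [_ u].
by rewrite -(u h) // (u k).
Qed.

(* A predicate on generalized elements of [X] is representable when it is the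
   extension of a map [X -> Omega]; the closure properties below are the
   Kripke-Joyal clauses for equality, conjunction, implication and universal
   quantification. *)
Definition representable X (phi : forall S, Hom S X -> Prop) : Prop :=
  exists chi : Hom X (Omega E), forall S f, chi ∘ f = top S <-> phi S f.

Lemma representable_ext X (phi psi : forall S, Hom S X -> Prop) :
  representable phi -> (forall S f, phi S f <-> psi S f) -> representable psi.
Proof.
by move=> [chi Hc] H; exists chi => S f; rewrite Hc H.
Qed.

Lemma representable_comp X Y (k : Hom X Y) (phi : forall S, Hom S Y -> Prop) :
  representable phi -> representable (fun S (f : Hom S X) => phi S (k ∘ f)).
Proof.
by move=> [chi Hc]; exists (chi ∘ k) => S f; rewrite -Hc comp_assoc.
Qed.

Lemma representable_monic A X (m : Hom A X) : monic m ->
  representable (fun S (f : Hom S X) => exists g, m ∘ g = f).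
Proof. exact: char_of_monic. Qed.

Lemma representable_eq X Y (a b : Hom X Y) :
  representable (fun S (f : Hom S X) => a ∘ f = b ∘ f).
Proof.
apply: representable_ext (representable_monic (equ_monic (f:=a) (g:=b))) _ => S f.
by rewrite -equ_factor.
Qed.

Lemma representable_true X (chi : Hom X (Omega E)) :
  representable (fun S f => chi ∘ f = top S).
Proof. by exists chi. Qed.

Lemma representable_and X (phi psi : forall S, Hom S X -> Prop) :
  representable phi -> representable psi ->
  representable (fun S f => phi S f /\ psi S f).
Proof.
move=> [c Hc] [d Hd].
apply: representable_ext (representable_eq ⟨c, d⟩ ⟨top X, top X⟩) _ => S f.
rewrite !pair_comp top_comp -Hc -Hd; split; first exact: pair_inj.
by case=> -> ->.
Qed.

Lemma representable_imp X (phi psi : forall S, Hom S X -> Prop) :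
  representable phi -> representable psi ->
  representable (fun S f => forall S' (g : Hom S' S), phi S' (f ∘ g) -> psi S' (f ∘ g)).
Proof.
move=> rphi rpsi; case: (representable_and rphi rpsi) => cd Hcd.
case: rphi => c Hc.
apply: representable_ext (representable_eq c cd) _ => S f; split.
- move=> e S' g /Hc; rewrite comp_assoc e -comp_assoc; by case/Hcd.
- move=> H; apply: Omega_ext => S' g; rewrite -!comp_assoc Hc Hcd.
  by split; [move=> h; split => //; apply: H | case].
Qed.

(** A predicate holds for all elements of [T] exactly when the transpose of its classifying map
    equals the transpose of [top]. *)
Lemma representable_all X T (phi : forall S, Hom S (X × T) -> Prop) :
  representable phi ->
  representable (fun S (f : Hom S X) =>
    forall S' (g : Hom S' S) (t : Hom S' T), phi S' ⟨f ∘ g, t⟩).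
Proof.
move=> [c Hc]; case: (curry c) => h Hh; case: (curry (top (X × T))) => k Hk.
apply: representable_ext (representable_eq h k) _ => S f; split.
- by move=> e S' g t; apply/Hc; rewrite -Hh comp_assoc e -comp_assoc Hk top_comp.
- move=> H; apply: curry_inj; rewrite -!comp_assoc Hh Hk top_comp; apply/Hc.
  exact: H.
Qed.

(** The last clause is disjunction elimination at an arbitrary stage [S]: a truth value that holds
    on both pieces holds. *)
Definition stable_union X A B W (m : Hom A X) (n : Hom B X) (w : Hom W X) : Prop :=
  [/\ monic w, sub_le m w, sub_le n w &
    forall S (f : Hom S W) (q : Hom S (Omega E)),
      (forall S' (g : Hom S' S) a, w ∘ (f ∘ g) = m ∘ a -> q ∘ g = top S') ->
      (forall S' (g : Hom S' S) b, w ∘ (f ∘ g) = n ∘ b -> q ∘ g = top S') ->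
      q = top S].

(* The union is defined impredicatively, by quantifying over the truth value
   [q] to be proved; this makes its elimination rule stable under pullback. *)
Lemma stable_union_exists X A B (m : Hom A X) (n : Hom B X) : monic m -> monic n ->
  exists W (w : Hom W X), stable_union m n w.
Proof.
move=> mm mn.
have rq : representable (fun S (f : Hom S (X × Omega E)) => pr2 ∘ f = top S).
  exact: representable_true.
have rc D (l : Hom D X) (ml : monic l) := representable_imp
  (representable_comp (@pr1 _ X (Omega E)) (representable_monic ml)) rq.
case: (representable_all (representable_imp
  (representable_and (rc _ _ mm) (rc _ _ mn)) rq)) => chi Hchi {rc rq}.
case: (comprehension chi) => W [w [mw Hw]]; exists W, w; split => //.
- apply/Hw/Hchi => S g t S' g' [H _].
  move: (H S' (idm _)); rewrite comp_idr; apply.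
  by exists (g ∘ g'); cat.
- apply/Hw/Hchi => S g t S' g' [_ H].
  move: (H S' (idm _)); rewrite comp_idr; apply.
  by exists (g ∘ g'); cat.
- move=> S f q Ha Hb.
  have /Hw/Hchi : exists g, w ∘ g = w ∘ f by exists f.
  move=> /(_ S (idm S) q S (idm S)); cat; apply.
  split=> S' g; cat; case=> a e; [apply: (Ha _ _ a) | apply: (Hb _ _ a)]; by rewrite e.
Qed.

(** Equality of [x] and [y] is itself a truth value, so the elimination rule applies to it. *)
Lemma stable_union_eq X A B W (m : Hom A X) (n : Hom B X) (w : Hom W X)
    S (f : Hom S W) Z (x y : Hom S Z) : stable_union m n w ->
  (forall S' (g : Hom S' S) a, w ∘ (f ∘ g) = m ∘ a -> x ∘ g = y ∘ g) ->
  (forall S' (g : Hom S' S) b, w ∘ (f ∘ g) = n ∘ b -> x ∘ g = y ∘ g) ->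
  x = y.
Proof.
move=> [_ _ _ elim] Ha Hb; case: (representable_eq x y) => q Hq.
move: (Hq S (idm S)); rewrite !comp_idr => <-.
by apply: (elim S f) => S' g c e; apply/Hq; [apply: Ha e | apply: Hb e].
Qed.

Lemma stable_union_is_union X A B W (m : Hom A X) (n : Hom B X) (w : Hom W X) :
  stable_union m n w -> is_union m n w.
Proof.
move=> [mw lm ln elim]; split=> //; split=> //; split=> //.
move=> V v mv [a ea] [b eb]; case: (char_of_monic mv) => chi Hchi.
apply/Hchi; apply: (elim W (idm W)) => S g c; rewrite comp_idl -comp_assoc => ->;
  apply/Hchi.
- by exists (a ∘ c); rewrite comp_assoc ea.
- by exists (b ∘ c); rewrite comp_assoc eb.
Qed.

(* A pair of compatible maps out of [A] and [B] is glued by taking the union of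
   their graphs, whose projection to [X] is again a monomorphism. *)
Lemma effective_union X A B P (m : Hom A X) (n : Hom B X)
    (p : Hom P A) (q : Hom P B) : monic m -> monic n -> is_pullback m n p q ->
  exists W (w : Hom W X) (j : Hom A W) (k : Hom B W),
    [/\ is_union m n w, w ∘ j = m, w ∘ k = n & is_pushout p q j k].
Proof.
move=> mm mn [epq upq].
case: (stable_union_exists mm mn) => W [w sw].
have uw := stable_union_is_union sw; have [mw [j ej] [k ek] _] := sw.
exists W, w, j, k; split=> //.
split; first by apply: mw; rewrite !comp_assoc ej ek.
move=> Z a b eab.
have agree S (s : Hom S A) (t : Hom S B) : m ∘ s = n ∘ t -> a ∘ s = b ∘ t.
  by case/upq=> l [[<- <-] _]; rewrite !comp_assoc eab.
have mma : monic ⟨m, a⟩ by move=> S f g; rewrite !pair_comp => /pair_inj [/mm].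
have mnb : monic ⟨n, b⟩ by move=> S f g; rewrite !pair_comp => /pair_inj [/mn].
case: (stable_union_exists mma mnb) => G [g sg].
have [mg [ja eja] [jb ejb] _] := sg.
(* Two elements of [G] over the same element of [X] each lie locally on one of the two graphs; in
   the mixed cases [agree] identifies their second components. *)
have mg1 : monic (pr1 ∘ g).
  move=> S s s'; rewrite -!comp_assoc => e; apply: mg; apply: pair_ext => //.
  have e1 S1 S2 (h : Hom S1 S) (h' : Hom S2 S1) :
      pr1 ∘ (g ∘ (s ∘ h)) ∘ h' = pr1 ∘ (g ∘ (s' ∘ h ∘ h')).
    by rewrite !comp_assoc in e *; rewrite e.
  have e2 S1 S2 (h : Hom S1 S) (h' : Hom S2 S1) u :
    pr2 ∘ (g ∘ u) ∘ h ∘ h' = pr2 ∘ (g ∘ (u ∘ h)) ∘ h' by cat.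
  have e3 S1 S2 (h : Hom S1 S) (h' : Hom S2 S1) u :
    pr2 ∘ (g ∘ u) ∘ h ∘ h' = pr2 ∘ (g ∘ (u ∘ h ∘ h')) by cat.
  apply: (stable_union_eq (f := s) sg) => S1 h c ec;
  apply: (stable_union_eq (f := s' ∘ h) sg) => S2 h' c' ec';
  move: (e1 S1 S2 h h'); rewrite e2 e3 ec ec'; cat => {}e1.
  - by congr comp; apply: mm.
  - exact: agree.
  - by symmetry; apply: agree.
  - by congr comp; apply: mn.
(* The projection of the union of graphs contains [A] and [B], hence [W]; the second component of
   [g ∘ l] is then the glued map. *)
have [l el] : sub_le w (pr1 ∘ g).
  case: uw => _ [_ [_ H]]; apply: H => //.
  - by exists ja; rewrite assocr eja pr1_pair.
  - by exists jb; rewrite assocr ejb pr1_pair.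
have lj : l ∘ j = ja.
  by apply: mg1; rewrite (comp_assoc _ l) el ej assocr eja pr1_pair.
have lk : l ∘ k = jb.
  by apply: mg1; rewrite (comp_assoc _ l) el ek assocr ejb pr1_pair.
exists (pr2 ∘ (g ∘ l)); split.
  by rewrite !assocr lj lk eja ejb !pr2_pair.
move=> h [hj hk]; apply: (stable_union_eq (f := idm W) sw) => S s c.
- rewrite comp_idl -ej assocr => /mw ->.
  by rewrite (comp_assoc h) hj !assocr (comp_assoc l) lj (comp_assoc g) eja; cat.
- rewrite comp_idl -ek assocr => /mw ->.
  by rewrite (comp_assoc h) hk !assocr (comp_assoc l) lk (comp_assoc g) ejb; cat.
Qed.

End InternalLogic.

(** * Products with colimits, and Leibniz products as unions *)

Section ProductsAndColimits.
Variable E : Topos.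
Implicit Types A B S T W X Y Z : E.

Lemma curryl A Z B (f : Hom (A × Z) B) :
  exists h : Hom Z (exp A B), forall S (z : Hom S Z) (a : Hom S A),
    ev A B ∘ ⟨h ∘ z, a⟩ = f ∘ ⟨a, z⟩.
Proof.
case: (curry (f ∘ ⟨pr2, pr1⟩)) => h Hh; exists h => S z a; rewrite Hh; by cat.
Qed.

Lemma curryl_inj A Z B (h k : Hom Z (exp A B)) :
  ev A B ∘ ⟨h ∘ pr2, pr1⟩ = ev A B ∘ ⟨k ∘ pr2, pr1⟩ -> h = k.
Proof.
move=> e; apply: curry_inj.
by move/(f_equal (fun f => f ∘ ⟨pr2, pr1⟩)): e; cat.
Qed.

(** Maps out of a product with [T] transpose to maps into [exp T Z], where the universal property of
    the given pushout applies. *)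
Lemma prod_pushout T A B P X (f : Hom X A) (g : Hom X B) (p : Hom A P) (q : Hom B P) :
  is_pushout f g p q ->
  is_pushout (prod_map (idm T) f) (prod_map (idm T) g)
             (prod_map (idm T) p) (prod_map (idm T) q).
Proof.
move=> [e u]; split; first by cat; rewrite !comp_assoc e.
move=> Z a b eab; case: (curryl a) => a' Ha; case: (curryl b) => b' Hb.
have [] := u _ a' b'.
  apply: curryl_inj; rewrite !assocr Ha Hb; move: eab; by cat.
move=> h [[ha hb] hu]; exists (ev T Z ∘ ⟨h ∘ pr2, pr1⟩); split.
  split; cat; rewrite comp_assoc ?ha ?hb ?Ha ?Hb; by cat.
move=> k [ka kb]; case: (curryl k) => k' Hk.
rewrite (hu k'); last by rewrite Hk; cat.
split; apply: curryl_inj; rewrite !assocr Hk ?Ha ?Hb -?ka -?kb; by cat.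
Qed.

Lemma pushout_ext A B P X Z (f : Hom X A) (g : Hom X B) (p : Hom A P) (q : Hom B P)
    (h k : Hom P Z) : is_pushout f g p q ->
  h ∘ p = k ∘ p -> h ∘ q = k ∘ q -> h = k.
Proof.
move=> [e u] ep eq; have [] := u Z (h ∘ p) (h ∘ q).
  by rewrite !assocr e.
by move=> l [_ ul]; rewrite -(ul h) // (ul k).
Qed.

Lemma coproduct_ext A B S Z (i : Hom A S) (j : Hom B S) (h k : Hom S Z) :
  is_coproduct i j -> h ∘ i = k ∘ i -> h ∘ j = k ∘ j -> h = k.
Proof.
move=> u ei ej; have [l [_ ul]] := u Z (h ∘ i) (h ∘ j).
by rewrite -(ul h) // (ul k).
Qed.

Lemma prod_map_pullback A B C D (f : Hom A B) (g : Hom C D) : monic f -> monic g ->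
  is_pullback (prod_map (idm B) g) (prod_map f (idm D))
              (prod_map f (idm C)) (prod_map (idm A) g).
Proof.
move=> mf mg; split; first by cat.
move=> Z a b e; exists ⟨pr1 ∘ b, pr2 ∘ a⟩.
have [e1 e2] : pr1 ∘ a = f ∘ (pr1 ∘ b) /\ g ∘ (pr2 ∘ a) = pr2 ∘ b.
  by move: e; cat => /pair_inj.
split.
  by split; apply: pair_ext; cat; rewrite ?e1 ?e2.
by move=> h [<- <-]; apply: pair_ext; cat.
Qed.

Lemma monic_prod_mapl T A B (u : Hom A B) : monic u -> monic (prod_map (idm T) u).
Proof.
move=> mu Z f g; cat => /pair_inj [e1 e2]; apply: pair_ext => //; exact: mu.
Qed.

Lemma monic_prod_mapr T A B (u : Hom A B) : monic u -> monic (prod_map u (idm T)).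
Proof.
move=> mu Z f g; cat => /pair_inj [e1 e2]; apply: pair_ext => //; exact: mu.
Qed.

Lemma leibniz_product_exists A B C D (f : Hom A B) (g : Hom C D) :
  monic f -> monic g -> exists P (w : Hom P (B × D)), is_leibniz_product f g w.
Proof.
move=> mf mg.
case: (effective_union (monic_prod_mapl (T:=B) mg) (monic_prod_mapr (T:=D) mf) (prod_map_pullback mf mg)).
by move=> W [w [j [k [_ ej ek po]]]]; exists W, w, j, k.
Qed.

(** Pushouts are unique up to isomorphism, so every Leibniz product is isomorphic to the effective
    union of its two sides. *)
Lemma leibniz_product_is_union A B C D P (f : Hom A B) (g : Hom C D) (w : Hom P (B × D)) :
  monic f -> monic g -> is_leibniz_product f g w ->
  is_union (prod_map (idm B) g) (prod_map f (idm D)) w.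
Proof.
move=> mf mg [j1 [j2 [po [e1 e2]]]].
case: (effective_union (monic_prod_mapl (T:=B) mg) (monic_prod_mapr (T:=D) mf) (prod_map_pullback mf mg)).
move=> W [w' [j [k [[mw' [_ [_ uw']]] ej ek po']]]].
case: (po) => eo uo; case: (po') => eo' uo'.
case: (uo' _ _ _ eo) => b [[bj bk] _].
case: (uo _ _ _ eo') => a [[aj ak] _].
have ba : b ∘ a = idm P.
  by apply: (pushout_ext po); rewrite assocr ?aj ?ak comp_idl.
have ea : w' ∘ a = w.
  by apply: (pushout_ext po); rewrite assocr ?aj ?ak ?ej ?ek.
split.
  move=> Z x y; rewrite -ea !assocr => /mw' e.
  by rewrite -[x]comp_idl -[y]comp_idl -ba !assocr e.
split; first by exists j1.
split; first by exists j2.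
move=> V v mv lm ln; case: (uw' V v mv lm ln) => l el.
by exists (l ∘ a); rewrite comp_assoc el.
Qed.

End ProductsAndColimits.

(** * The coproduct 1 + 1, the strict initial object, and endpoints as cofibrations *)

Section IntervalTheory.
Variables (E : Topos) (I : Interval E).
Implicit Types A B S T W X Y Z : E.

Lemma two_prod_coproduct B :
  is_coproduct ⟨two_inl I ∘ bang B, idm B⟩ ⟨two_inr I ∘ bang B, idm B⟩.
Proof.
move=> X f g.
case: (curry (f ∘ @pr2 _ one B)) => f' Hf; case: (curry (g ∘ @pr2 _ one B)) => g' Hg.
case: (@two_is_coproduct _ I _ f' g') => h [[hf hg] hu].
exists (ev B X ∘ ⟨h ∘ pr1, pr2⟩); split.
  by split; cat; rewrite comp_assoc ?hf ?hg ?Hf ?Hg; cat.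
move=> k [kf kg]; case: (curry k) => k' Hk.
rewrite (hu k'); last by rewrite Hk; cat.
split; apply: curry_inj; rewrite !assocr Hk ?Hf ?Hg -?kf -?kg; cat;
  by rewrite -(bang_unique pr1).
Qed.

Lemma initial_ext Z X (f g : Hom Z X) : is_initial Z -> f = g.
Proof. by move=> /(_ X) [h [_ u]]; rewrite -(u f) // (u g). Qed.

(* If the two points of [1 + 1] agree over [S], then parallel maps out of any
   object over [S] agree; so [S × X -> S] is a monomorphism with the same
   classifying map as the identity of [S], hence invertible. *)
Lemma degenerate_initial S : two_inl I ∘ bang S = two_inr I ∘ bang S -> is_initial S.
Proof.
move=> e.
have eqS T (t : Hom T S) X (f g : Hom T X) : f = g.
  have [h [[<- <-] _]] := two_prod_coproduct f g.
  by rewrite -(bang_comp t) !comp_assoc e.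
move=> X.
have m1 : monic (@pr1 _ S X) by move=> Z f g _; apply: (eqS Z (pr1 ∘ f)).
case: (char_of_monic m1) => chi Hchi.
have [g eg] : exists g, @pr1 _ S X ∘ g = idm S by apply/Hchi; apply: (eqS S (idm S)).
exists (pr2 ∘ g); split=> // f _; exact: (eqS S (idm S)).
Qed.

Lemma initial_strict S Z : is_initial Z -> Hom S Z -> is_initial S.
Proof.
move=> iZ f; apply: degenerate_initial; rewrite -(bang_comp f) !comp_assoc.
by congr comp; apply: initial_ext.
Qed.

Lemma initial_exists : exists Z : E, is_initial Z.
Proof.
case: (equ_is_equalizer (two_inl I) (two_inr I)) => e _.
exists (equ (two_inl I) (two_inr I)); apply: degenerate_initial.
by rewrite -(bang_unique (equ_map _ _)).
Qed.

Lemma two_cases S (f : Hom S (two I)) (q : Hom S (Omega E)) :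
  (forall S' (g : Hom S' S), f ∘ g = two_inl I ∘ bang S' -> q ∘ g = top S') ->
  (forall S' (g : Hom S' S), f ∘ g = two_inr I ∘ bang S' -> q ∘ g = top S') ->
  q = top S.
Proof.
move=> Hl Hr.
(* On [two I × S], consider the predicate saying that if [f] of the second component equals the
   first, then [q] holds. It is true on both summands, hence everywhere, and is then evaluated at
   [⟨f, idm S⟩]. *)
case: (representable_imp (representable_eq (f ∘ pr2) (@pr1 _ (two I) S))
  (representable_true (q ∘ pr2))) => psi Hpsi.
have epsi : psi = top _.
  apply: (coproduct_ext (@two_prod_coproduct S)); rewrite top_comp; apply/Hpsi => S' g;
  cat; [exact: Hl | exact: Hr].
move: (Hpsi S ⟨f, idm S⟩); rewrite epsi top_comp => -[/(_ eq_refl) H _].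
by move: (H S (idm S)); cat; apply.
Qed.

Lemma endpoint_monic i : monic (endpoint I i).
Proof. move=> Z f g _; exact: to_one_eq. Qed.

Variables (C : MorClass E) (hC : cofibration_class I C).

Let C_monic A B (u : Hom A B) : C u -> monic u := dom_monic (cof_dominance hC) (u := u).

Lemma cof_prod_mapl T A B (u : Hom A B) : C u -> C (prod_map (idm T) u).
Proof.
move=> cu; apply: (dom_pullback (cof_dominance hC) (f := pr2) (u := u) (q := pr2)) => //.
split; first by cat.
move=> Z a b e; exists ⟨pr1 ∘ a, b⟩; split.
  by split; [apply: pair_ext|]; cat.
move=> h [<- <-]; apply: pair_ext; by cat.
Qed.

Lemma cof_prod_mapr T A B (u : Hom A B) : C u -> C (prod_map u (idm T)).
Proof.
move=> cu; apply: (dom_pullback (cof_dominance hC) (f := pr1) (u := u) (q := pr1)) => //.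
split; first by cat.
move=> Z a b e; exists ⟨b, pr2 ∘ a⟩; split.
  by split; [apply: pair_ext|]; cat.
move=> h [<- <-]; apply: pair_ext; by cat.
Qed.

Lemma cof_leibniz_product A B K L P (f : Hom A B) (g : Hom K L) (w : Hom P (B × L)) :
  C f -> C g -> is_leibniz_product f g w -> C w.
Proof.
move=> cf cg lw.
apply: (cof_union hC (cof_prod_mapl B cg) (cof_prod_mapr L cf)).
by apply: leibniz_product_is_union lw; apply: C_monic.
Qed.

(* The inclusion of a point in [1 + 1] is classified by the map sending that
   point to "true" and the other one to "false". *)
Lemma cof_two_inj (i j : Hom one (two I)) : is_coproduct i j ->
  (forall S (f : Hom S (two I)) (q : Hom S (Omega E)),
    (forall S' (g : Hom S' S), f ∘ g = i ∘ bang S' -> q ∘ g = top S') ->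
    (forall S' (g : Hom S' S), f ∘ g = j ∘ bang S' -> q ∘ g = top S') -> q = top S) ->
  C i.
Proof.
move=> ij cases.
case: (dom_terminal (cof_dominance hC)) => T0 [T1 [t [ct ut]]].
case: initial_exists => Z iZ.
case: (ut _ _ _ (cof_initial hC (bang Z) iZ)) => -[z0 z1] [/= [ez uz] _].
have c1 : C (idm (one : E)).
  by apply: (dom_iso (cof_dominance hC)); exists (idm one); rewrite !comp_idl.
case: (ut _ _ _ c1) => -[a0 a1] [/= [ea _] _].
(* [a1] classifies all of [one] and [z1] its empty subobject. *)
case: (ij T1 a1 z1) => c [[ci cj] _].
apply: (dom_pullback (cof_dominance hC) (f := c) (u := t) (q := a0)) => //.
split; first by rewrite ci -ea comp_idr.
move=> S f b e; exists (bang S); split; last by move=> h _; rewrite (bang_unique h).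
have ef : i ∘ bang S = f.
  case: (representable_eq (i ∘ bang S) f) => q Hq.
  move: (Hq S (idm S)); rewrite !comp_idr => <-.
  apply: (cases _ f) => S' g eg; apply/Hq; rewrite eg assocr bang_comp //.
  (* Where [f] is [j], the pullback square of [z1] yields a map to the initial object, so by
     strictness that stage is initial and all maps out of it agree. *)
  have [] := uz S' (bang S') (b ∘ g).
    by rewrite comp_assoc -e assocr eg comp_assoc cj.
  move=> l _; apply: initial_ext; exact: initial_strict iZ l.
split=> //; apply: (C_monic ct); rewrite -e comp_assoc -ea comp_idr -ci assocr.
by rewrite ef.
Qed.

Lemma cof_endpoint i : C (endpoint I i).
Proof.
apply: (dom_comp (cof_dominance hC)); last exact: cof_bdry hC.
case: i; [apply: (@cof_two_inj _ (two_inl I)) | apply: (@cof_two_inj _ (two_inr I))].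
- move=> X f g; case: (@two_is_coproduct _ I _ g f) => h [[e1 e2] u]; exists h; split=> //.
  by move=> k [k1 k2]; apply: u.
- by move=> S f q H1 H2; apply: (two_cases (f := f)).
- exact: two_is_coproduct.
- by move=> S f q H1 H2; apply: (two_cases (f := f)).
Qed.

End IntervalTheory.

(** * Filling open boxes in fibrations *)

Section BoxFilling.
Variables (E : Topos) (I : Interval E) (C : MorClass E) (hC : cofibration_class I C).
Implicit Types A B S T W X Y Z : E.

Let C_monic A B (u : Hom A B) : C u -> monic u := dom_monic (cof_dominance hC) (u := u).

(** [h] and [x] are the sides and the base of an open box over [k], glued along the pushout defining
    the Leibniz product. The filler is described on generalized elements so that later computations
    can rewrite with it. *)
Lemma fibration_fill X Y (p : Hom X Y) i A B (u : Hom A B)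
    (h : Hom (I × A) X) (x : Hom B X) (k : Hom (I × B) Y) :
  fibration I C p -> C u ->
  p ∘ h = k ∘ ⟨pr1, u ∘ pr2⟩ ->
  p ∘ x = k ∘ ⟨endpoint I i ∘ bang B, idm B⟩ ->
  x ∘ u = h ∘ ⟨endpoint I i ∘ bang A, idm A⟩ ->
  exists d : Hom (I × B) X, [/\ p ∘ d = k,
    forall S (b : Hom S B), d ∘ ⟨endpoint I i ∘ bang S, b⟩ = x ∘ b &
    forall S (t : Hom S I) (a : Hom S A), d ∘ ⟨t, u ∘ a⟩ = h ∘ ⟨t, a⟩].
Proof.
move=> fp cu eh ex exh.
case: (leibniz_product_exists (@endpoint_monic _ I i) (C_monic cu)) => P [w lw].
case: (lw) => j1 [j2 [po [e1 e2]]]; case: (po) => eo uo.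
have [] := uo X h (x ∘ pr2).
  move/(f_equal (fun f => f ∘ @pr2 _ one A)): exh; cat => ->.
  by rewrite (bang_unique pr1).
move=> t [[t1 t2] _].
have [] := fp i A B u P w cu lw t k.
  apply: (pushout_ext po).
  - by rewrite !assocr t1 e1 eh; cat.
  - rewrite !assocr t2 e2 comp_assoc ex; cat.
    by rewrite (bang_unique pr1).
move=> d [dt pd]; exists d; split=> //.
- move=> S b; move/(f_equal (fun f => d ∘ f ∘ ⟨bang S, b⟩)): e2.
  rewrite (comp_assoc d) dt t2; by cat=> ->.
- move=> S s a; move/(f_equal (fun f => d ∘ f ∘ ⟨s, a⟩)): e1.
  rewrite (comp_assoc d) dt t1; by cat=> ->.
Qed.

Lemma fibration_intro X Y (p : Hom X Y) :
  (forall i A B (u : Hom A B) (h : Hom (I × A) X) (x : Hom B X) (k : Hom (I × B) Y),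
    C u -> p ∘ h = k ∘ ⟨pr1, u ∘ pr2⟩ ->
    p ∘ x = k ∘ ⟨endpoint I i ∘ bang B, idm B⟩ ->
    x ∘ u = h ∘ ⟨endpoint I i ∘ bang A, idm A⟩ ->
    exists d : Hom (I × B) X, [/\ p ∘ d = k,
      d ∘ ⟨endpoint I i ∘ bang B, idm B⟩ = x & d ∘ ⟨pr1, u ∘ pr2⟩ = h]) ->
  fibration I C p.
Proof.
move=> H i A B u P w cu [j1 [j2 [po [e1 e2]]]] t k e.
case: (po) => eo _.
have [] := H i A B u (t ∘ j1) (t ∘ (j2 ∘ ⟨bang B, idm B⟩)) k cu.
- by rewrite comp_assoc e assocr e1; cat.
- rewrite comp_assoc e assocr (comp_assoc w) e2; by cat.
- move/(f_equal (fun f => f ∘ ⟨bang A, idm A⟩)): eo; cat=> ->.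
  by cat.
move=> d [dk dx dh]; exists d; split=> //; apply: (pushout_ext po).
- by rewrite assocr e1 -dh; cat.
- rewrite assocr e2; move/(f_equal (fun f => f ∘ @pr2 _ one B)): dx; cat.
  by rewrite -(bang_unique pr1) pair_pr comp_idr.
Qed.

Lemma two_copair T B X (s : bool -> Hom (T × B) X) :
  exists g : Hom (T × (two I × B)) X, forall S (t : Hom S T) (b : Hom S B),
    g ∘ ⟨t, ⟨two_inl I ∘ bang S, b⟩⟩ = s false ∘ ⟨t, b⟩ /\
    g ∘ ⟨t, ⟨two_inr I ∘ bang S, b⟩⟩ = s true ∘ ⟨t, b⟩.
Proof.
case: (two_prod_coproduct I (s false) (s true)) => g [[gl gr] _].
exists (g ∘ ⟨pr1 ∘ pr2, ⟨pr1, pr2 ∘ pr2⟩⟩) => S t b; rewrite -gl -gr.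
by split; cat.
Qed.

Lemma two_copair_ext T B X (f g : Hom (T × (two I × B)) X) :
  f ∘ ⟨pr1, ⟨two_inl I ∘ bang (T × B), pr2⟩⟩ = g ∘ ⟨pr1, ⟨two_inl I ∘ bang (T × B), pr2⟩⟩ ->
  f ∘ ⟨pr1, ⟨two_inr I ∘ bang (T × B), pr2⟩⟩ = g ∘ ⟨pr1, ⟨two_inr I ∘ bang (T × B), pr2⟩⟩ ->
  f = g.
Proof.
move=> el er.
pose sw := ⟨pr1 ∘ pr2, ⟨pr1, pr2 ∘ pr2⟩⟩ : Hom (two I × (T × B)) (T × (two I × B)).
have e : f ∘ sw = g ∘ sw.
  by apply: (coproduct_ext (@two_prod_coproduct _ I (T × B))); rewrite /sw; cat.
move/(f_equal (fun f => f ∘ ⟨pr1 ∘ pr2, ⟨pr1, pr2 ∘ pr2⟩⟩)): e; rewrite /sw; by cat.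
Qed.

(* The box is the Leibniz product of [∂_i] with the cofibration
   [{0,1} × B ∪ I × A -> I × B]. *)
Lemma fibration_fill_boundary X Y (p : Hom X Y) i A B (u : Hom A B)
    (k : Hom (I × (I × B)) Y) (x : Hom (I × B) X) (s : bool -> Hom (I × B) X)
    (h : Hom (I × (I × A)) X) :
  fibration I C p -> C u ->
  p ∘ x = k ∘ ⟨endpoint I i ∘ bang _, idm _⟩ ->
  (forall e, p ∘ s e = k ∘ ⟨pr1, ⟨endpoint I e ∘ bang _, pr2⟩⟩) ->
  p ∘ h = k ∘ ⟨pr1, ⟨pr1 ∘ pr2, u ∘ (pr2 ∘ pr2)⟩⟩ ->
  (forall e, s e ∘ ⟨endpoint I i ∘ bang B, idm B⟩ = x ∘ ⟨endpoint I e ∘ bang B, idm B⟩) ->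
  h ∘ ⟨endpoint I i ∘ bang _, idm _⟩ = x ∘ ⟨pr1, u ∘ pr2⟩ ->
  (forall e, h ∘ ⟨pr1, ⟨endpoint I e ∘ bang _, pr2⟩⟩ = s e ∘ ⟨pr1, u ∘ pr2⟩) ->
  exists d : Hom (I × (I × B)) X, [/\ p ∘ d = k,
    forall S (z : Hom S (I × B)), d ∘ ⟨endpoint I i ∘ bang S, z⟩ = x ∘ z,
    forall e S (t : Hom S I) (b : Hom S B),
      d ∘ ⟨t, ⟨endpoint I e ∘ bang S, b⟩⟩ = s e ∘ ⟨t, b⟩ &
    forall S (t t' : Hom S I) (a : Hom S A),
      d ∘ ⟨t, ⟨t', u ∘ a⟩⟩ = h ∘ ⟨t, ⟨t', a⟩⟩].
Proof.
move=> fp cu px ps ph sx hx hs.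
case: (two_copair s) => g Hg.
case: (leibniz_product_exists (bdry_monic (i := I)) (C_monic cu)) => W [v lv].
have cv : C v := cof_leibniz_product hC (cof_bdry hC) cu lv.
case: lv => j1 [j2 [po [e1 e2]]].
(* Since [I × -] preserves the pushout defining [W], the side [h] over [A] and the sides [s] at the
   two ends glue to one map on [I × W]. *)
have poI := prod_pushout I po; case: (poI) => _ uo.
have [] := uo X h g.
  apply: two_copair_ext; cat.
  - have [-> _] := Hg _ (@pr1 _ I A) (u ∘ pr2).
    by move: (hs false); rewrite /endpoint; cat=> <-.
  - have [_ ->] := Hg _ (@pr1 _ I A) (u ∘ pr2).
    by move: (hs true); rewrite /endpoint; cat=> <-.
move=> H [[H1 H2] _].
have v1 S (a : Hom S (I × A)) : v ∘ (j1 ∘ a) = ⟨pr1 ∘ a, u ∘ (pr2 ∘ a)⟩.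
  by rewrite comp_assoc e1; cat.
have v2 S (a : Hom S (two I × B)) : v ∘ (j2 ∘ a) = ⟨bdry I ∘ (pr1 ∘ a), pr2 ∘ a⟩.
  by rewrite comp_assoc e2; cat.
have H1' S t (a : Hom S (I × A)) : H ∘ ⟨t, j1 ∘ a⟩ = h ∘ ⟨t, a⟩.
  by rewrite -H1; cat.
have H2' S t (a : Hom S (two I × B)) : H ∘ ⟨t, j2 ∘ a⟩ = g ∘ ⟨t, a⟩.
  by rewrite -H2; cat.
have [] := fibration_fill (i := i) (h := H) (x := x) (k := k) fp cv.
- apply: (pushout_ext poI).
  + by rewrite !assocr H1 ph; cat; rewrite v1.
  + rewrite !assocr H2; apply: two_copair_ext; cat; rewrite v2; cat.
    * have [-> _] := Hg _ (@pr1 _ I B) pr2.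
      by move: (ps false); rewrite /endpoint; cat=> ->.
    * have [_ ->] := Hg _ (@pr1 _ I B) pr2.
      by move: (ps true); rewrite /endpoint; cat=> ->.
- exact: px.
- apply: (pushout_ext po).
  + rewrite assocr e1; cat; rewrite -[j1]comp_idr H1' hx; by cat.
  + apply: (coproduct_ext (@two_prod_coproduct _ I B)); cat; rewrite v2 H2'; cat.
    * have [-> _] := Hg _ (endpoint I i ∘ bang B) (idm B).
      by move: (sx false); rewrite /endpoint; cat=> ->.
    * have [_ ->] := Hg _ (endpoint I i ∘ bang B) (idm B).
      by move: (sx true); rewrite /endpoint; cat=> ->.
move=> d [dk dx dh]; exists d; split=> //.
- move=> e S t b.
  pose c := (if e then two_inr I else two_inl I) ∘ bang S.
  have -> : ⟨endpoint I e ∘ bang S, b⟩ = v ∘ (j2 ∘ ⟨c, b⟩).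
    by rewrite v2 /c /endpoint; cat.
  rewrite dh H2' /c; case: (Hg S t b); by case: (e).
- move=> S t t' a.
  have -> : ⟨t', u ∘ a⟩ = v ∘ (j1 ∘ ⟨t', a⟩) by rewrite v1; cat.
  by rewrite dh H1'.
Qed.

(** This is the boundary box with an initial object as [A]: by strictness, the conditions over [A]
    hold vacuously. *)
Lemma fibration_fill_ends X Y (p : Hom X Y) i B
    (k : Hom (I × (I × B)) Y) (x : Hom (I × B) X) (s : bool -> Hom (I × B) X) :
  fibration I C p ->
  p ∘ x = k ∘ ⟨endpoint I i ∘ bang _, idm _⟩ ->
  (forall e, p ∘ s e = k ∘ ⟨pr1, ⟨endpoint I e ∘ bang _, pr2⟩⟩) ->
  (forall e, s e ∘ ⟨endpoint I i ∘ bang B, idm B⟩ = x ∘ ⟨endpoint I e ∘ bang B, idm B⟩) ->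
  exists d : Hom (I × (I × B)) X, [/\ p ∘ d = k,
    forall S (z : Hom S (I × B)), d ∘ ⟨endpoint I i ∘ bang S, z⟩ = x ∘ z &
    forall e S (t : Hom S I) (b : Hom S B),
      d ∘ ⟨t, ⟨endpoint I e ∘ bang S, b⟩⟩ = s e ∘ ⟨t, b⟩].
Proof.
move=> fp px ps sx; case: (initial_exists I) => Z iZ.
case: (iZ B) => u _.
have iS S : Hom S Z -> is_initial S by exact: initial_strict.
case: (iS (I × (I × Z)) (pr2 ∘ pr2) X) => h _.
have [] := fibration_fill_boundary (i := i) (k := k) (x := x) (s := s) (h := h) fp
  (cof_initial hC u iZ) => //.
- exact/initial_ext/iS/(pr2 ∘ pr2).
- exact/initial_ext/iS/pr2.
- move=> e; exact/initial_ext/iS/pr2.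
by move=> d [d1 d2 d3 _]; exists d.
Qed.

(** The covering homotopy property is [fibration_fill] for the inclusion of an initial object. *)
Lemma fibration_lift_homotopy X Y (p : Hom X Y) i B (x : Hom B X) (k : Hom (I × B) Y) :
  fibration I C p -> p ∘ x = k ∘ ⟨endpoint I i ∘ bang B, idm B⟩ ->
  exists d : Hom (I × B) X, p ∘ d = k /\
    forall S (b : Hom S B), d ∘ ⟨endpoint I i ∘ bang S, b⟩ = x ∘ b.
Proof.
move=> fp px; case: (initial_exists I) => Z iZ; case: (iZ B) => u _.
have iS S : Hom S Z -> is_initial S by exact: initial_strict.
case: (iS (I × Z) pr2 X) => h _.
have [] := fibration_fill (i := i) (k := k) (x := x) (h := h) fp
  (cof_initial hC u iZ) => //.
- exact/initial_ext/iS/pr2.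
- exact: initial_ext.
by move=> d [d1 d2 _]; exists d.
Qed.

End BoxFilling.

(** * Connection identities on generalized elements *)

Section Connections.
Variables (E : Topos) (I : Interval E).
Implicit Types S : E.

Lemma meet_0r S (t : Hom S I) :
  meet I ∘ ⟨t, endpoint I false ∘ bang S⟩ = endpoint I false ∘ bang S.
Proof. by move/(f_equal (fun f => f ∘ t)): (meet_x0 I); rewrite /int0 /endpoint; cat. Qed.

Lemma meet_0l S (t : Hom S I) :
  meet I ∘ ⟨endpoint I false ∘ bang S, t⟩ = endpoint I false ∘ bang S.
Proof. by move/(f_equal (fun f => f ∘ t)): (meet_0x I); rewrite /int0 /endpoint; cat. Qed.

Lemma meet_1r S (t : Hom S I) : meet I ∘ ⟨t, endpoint I true ∘ bang S⟩ = t.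
Proof. by move/(f_equal (fun f => f ∘ t)): (meet_x1 I); rewrite /int1 /endpoint; cat. Qed.

Lemma join_0r S (t : Hom S I) : join I ∘ ⟨t, endpoint I false ∘ bang S⟩ = t.
Proof. by move/(f_equal (fun f => f ∘ t)): (join_x0 I); rewrite /int0 /endpoint; cat. Qed.

Lemma join_0l S (t : Hom S I) : join I ∘ ⟨endpoint I false ∘ bang S, t⟩ = t.
Proof. by move/(f_equal (fun f => f ∘ t)): (join_0x I); rewrite /int0 /endpoint; cat. Qed.

Lemma join_1r S (t : Hom S I) :
  join I ∘ ⟨t, endpoint I true ∘ bang S⟩ = endpoint I true ∘ bang S.
Proof. by move/(f_equal (fun f => f ∘ t)): (join_x1 I); rewrite /int1 /endpoint; cat. Qed.

Lemma join_1l S (t : Hom S I) :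
  join I ∘ ⟨endpoint I true ∘ bang S, t⟩ = endpoint I true ∘ bang S.
Proof. by move/(f_equal (fun f => f ∘ t)): (join_1x I); rewrite /int1 /endpoint; cat. Qed.

End Connections.

(** * Homotopy equivalences, retracts and lifting properties *)

Section Homotopies.
Variables (E : Topos) (I : Interval E) (C : MorClass E) (hC : cofibration_class I C).
Implicit Types A B S T W X Y Z : E.

Lemma homotopicP B A (f g : Hom B A) : homotopic I f g <->
  exists H : Hom (I × B) A, forall S (b : Hom S B),
    H ∘ ⟨endpoint I false ∘ bang S, b⟩ = f ∘ b /\
    H ∘ ⟨endpoint I true ∘ bang S, b⟩ = g ∘ b.
Proof.
split=> -[H].
- by move=> [<- <-]; exists H => S b; cat.
- by move=> e; exists H; case: (e B (idm B)); cat.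
Qed.

Lemma homotopic_refl B A (f : Hom B A) : homotopic I f f.
Proof. by apply/homotopicP; exists (f ∘ pr2) => S b; cat. Qed.

Lemma homotopic_compl B A A' (f g : Hom B A) (h : Hom A A') :
  homotopic I f g -> homotopic I (h ∘ f) (h ∘ g).
Proof. by case=> H [<- <-]; exists (h ∘ H); rewrite !comp_assoc. Qed.

Lemma homotopic_compr B B' A (f g : Hom B A) (h : Hom B' B) :
  homotopic I f g -> homotopic I (f ∘ h) (g ∘ h).
Proof. by case=> H [<- <-]; exists (H ∘ ⟨pr1, h ∘ pr2⟩); cat. Qed.

(** Fill the square whose base and right side are constant at [f] and whose left side is [H]; its
    lid runs from [g] to [f]. *)
Lemma homotopic_sym B A (f g : Hom B A) : fibrant I C A ->
  homotopic I f g -> homotopic I g f.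
Proof.
move=> fA /homotopicP [H HH].
have [] := fibration_fill_ends hC (p := bang A) (i := false) (k := bang _) (x := f ∘ pr2)
  (s := fun e : bool => if e then f ∘ pr2 else H) fA; try by move=> *; apply: to_one_eq.
  by case; cat=> //; have [-> _] := HH _ (idm B); cat.
move=> d [_ _ ds]; apply/homotopicP; exists (d ∘ ⟨endpoint I true ∘ bang _, idm _⟩) => S b.
cat; rewrite !ds; have [_ ->] := HH _ b; by cat.
Qed.

(** Fill the square with base [H], left side constant at [f] and right side [K]; its lid runs from
    [f] to [h]. *)
Lemma homotopic_trans B A (f g h : Hom B A) : fibrant I C A ->
  homotopic I f g -> homotopic I g h -> homotopic I f h.
Proof.
move=> fA /homotopicP [H HH] /homotopicP [K HK].
have [] := fibration_fill_ends hC (p := bang A) (i := false) (k := bang _) (x := H)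
  (s := fun e : bool => if e then K else f ∘ pr2) fA; try by move=> *; apply: to_one_eq.
  by case; cat; have [e1 e2] := HH _ (idm B); have [e3 e4] := HK _ (idm B);
    rewrite ?e1 ?e2 ?e3; cat.
move=> d [_ _ ds]; apply/homotopicP; exists (d ∘ ⟨endpoint I true ∘ bang _, idm _⟩) => S b.
cat; rewrite !ds; have [_ ->] := HK _ b; by cat.
Qed.

Lemma heq_comp X Y Z (f : Hom X Y) (g : Hom Y Z) : fibrant I C X -> fibrant I C Z ->
  homotopy_equivalence I f -> homotopy_equivalence I g -> homotopy_equivalence I (g ∘ f).
Proof.
move=> fX fZ [f' [f1 f2]] [g' [g1 g2]]; exists (f' ∘ g'); split.
- have := homotopic_compl f' (homotopic_compr f g1); rewrite comp_idl !comp_assoc => e.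
  exact: homotopic_trans e f1.
- have := homotopic_compl g (homotopic_compr g' f2); rewrite comp_idl !comp_assoc => e.
  exact: homotopic_trans e g2.
Qed.

(** If [h] inverts [g f], then [f h] inverts [g]: [f h g ~ f h g f f' ~ f f' ~ 1]. *)
Lemma heq_left X Y Z (f : Hom X Y) (g : Hom Y Z) :
  fibrant I C X -> fibrant I C Y -> fibrant I C Z ->
  homotopy_equivalence I f -> homotopy_equivalence I (g ∘ f) -> homotopy_equivalence I g.
Proof.
move=> fX fY fZ [f' [f1 f2]] [h [h1 h2]]; exists (f ∘ h); split; last by rewrite comp_assoc.
have e1 : homotopic I (f ∘ h ∘ g ∘ (f ∘ f')) (f ∘ h ∘ g).
  by have := homotopic_compl (f ∘ h ∘ g) f2; rewrite comp_idr.
have e2 : homotopic I (f ∘ h ∘ g ∘ (f ∘ f')) (f ∘ f').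
  by have := homotopic_compl f (homotopic_compr f' h1); rewrite comp_idl !comp_assoc.
apply: homotopic_trans (homotopic_sym fY e1) _ => //.
exact: homotopic_trans e2 f2.
Qed.

(** If [h] inverts [g f], then [h g] inverts [f]: [f h g ~ g' g f h g ~ g' g ~ 1]. *)
Lemma heq_right X Y Z (f : Hom X Y) (g : Hom Y Z) :
  fibrant I C X -> fibrant I C Y -> fibrant I C Z ->
  homotopy_equivalence I g -> homotopy_equivalence I (g ∘ f) -> homotopy_equivalence I f.
Proof.
move=> fX fY fZ [g' [g1 g2]] [h [h1 h2]]; exists (h ∘ g); split; first by rewrite assocr.
have e1 : homotopic I (g' ∘ g ∘ (f ∘ (h ∘ g))) (f ∘ (h ∘ g)).
  by have := homotopic_compr (f ∘ (h ∘ g)) g1; rewrite comp_idl.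
have e2 : homotopic I (g' ∘ g ∘ (f ∘ (h ∘ g))) (g' ∘ g).
  by have := homotopic_compl g' (homotopic_compr g h2); rewrite comp_idl !comp_assoc.
apply: homotopic_trans (homotopic_sym fY e1) _ => //.
exact: homotopic_trans e2 g1.
Qed.

Lemma heq_retract A B X Y (f : Hom A B) (g : Hom X Y) :
  is_retract f g -> homotopy_equivalence I g -> homotopy_equivalence I f.
Proof.
move=> [s [r [s' [r' [rs [rs' [gs fr]]]]]]] [g' [g1 g2]]; exists (r ∘ g' ∘ s'); split.
- have := homotopic_compl r (homotopic_compr s g1).
  by rewrite comp_idl rs !assocr gs.
- have := homotopic_compl r' (homotopic_compr s' g2).
  by rewrite comp_idl rs' !comp_assoc -fr.
Qed.

(** As [g] is monic, its retract [f] is the pullback of [g] along [s']. *)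
Lemma cof_retract A B X Y (f : Hom A B) (g : Hom X Y) : is_retract f g -> C g -> C f.
Proof.
move=> [s [r [s' [r' [rs [rs' [gs fr]]]]]]] cg.
have mg := dom_monic (cof_dominance hC) cg.
apply: (dom_pullback (cof_dominance hC) (f := s') (u := g) (q := s)) => //.
split=> // Z a b e; exists (r ∘ b).
have fa : f ∘ (r ∘ b) = a by rewrite comp_assoc fr assocr -e comp_assoc rs' comp_idl.
split.
  by split=> //; apply: mg; rewrite comp_assoc gs assocr fa.
by move=> h [_ <-]; rewrite comp_assoc rs comp_idl.
Qed.

Lemma rlp_retract U V A B X Y (u : Hom U V) (f : Hom A B) (g : Hom X Y) :
  is_retract f g -> rlp u g -> rlp u f.
Proof.
move=> [s [r [s' [r' [rs [rs' [gs fr]]]]]]] H t b e.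
have [] := H (s ∘ t) (s' ∘ b); first by rewrite comp_assoc gs !assocr e.
move=> d [d1 d2]; exists (r ∘ d); split.
- by rewrite assocr d1 comp_assoc rs comp_idl.
- by rewrite comp_assoc fr assocr d2 comp_assoc rs' comp_idl.
Qed.

Lemma fibration_comp X Y Z (p : Hom X Y) (q : Hom Y Z) :
  fibration I C p -> fibration I C q -> fibration I C (q ∘ p).
Proof.
move=> fp fq i A B u P w cu lw t b e.
have [d [d1 d2]] := fq i A B u P w cu lw (p ∘ t) b (eq_trans (comp_assoc _ _ _) e).
have [d' [d3 d4]] := fp i A B u P w cu lw t d (eq_sym d1).
by exists d'; rewrite d3 assocr d4 d2.
Qed.

Lemma fibrant_total X Y (p : Hom X Y) : fibration I C p -> fibrant I C Y -> fibrant I C X.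
Proof. by move=> fp fY; rewrite /fibrant -(bang_comp p); apply: fibration_comp. Qed.

Definition trivial_fibration : MorClass E := fun X Y p =>
  forall A B (u : Hom A B), C u -> rlp u p.

Lemma trivial_fibration_fibration X Y (p : Hom X Y) :
  trivial_fibration p -> fibration I C p.
Proof.
move=> tp i A B u P w cu lw; apply: tp.
exact: (cof_leibniz_product hC (cof_endpoint hC i) cu lw).
Qed.

(** Lifting against [0 -> Y] gives a section [s]; lifting against [{0,1} × X -> I × X] joins [s p]
    to the identity. *)
Lemma trivial_fibration_heq X Y (p : Hom X Y) :
  trivial_fibration p -> homotopy_equivalence I p.
Proof.
move=> tp; case: (initial_exists I) => Z iZ.
case: (iZ X) => zX _; case: (iZ Y) => zY _.
have [s [_ ps]] := tp _ _ _ (cof_initial hC zY iZ) zX (idm Y) (initial_ext _ _ iZ).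
exists s; split; last by rewrite ps; apply: homotopic_refl.
case: (two_prod_coproduct I (s ∘ p) (idm X)) => g [[g0 g1] _].
have [] := tp _ _ _ (cof_prod_mapr hC X (cof_bdry hC)) g (p ∘ pr2).
  apply: (coproduct_ext (@two_prod_coproduct _ I X)); rewrite assocr ?g0 ?g1; cat=> //.
  by rewrite comp_assoc ps comp_idl.
move=> d [dg _]; exists d; split.
- by rewrite -g0 -dg /at_end /endpoint; cat.
- by rewrite -[RHS]g1 -dg /at_end /endpoint; cat.
Qed.

(* First the homotopy [f g ~ 1] is lifted to replace [g] by a strict section
   [s]; then the homotopy [K : s f ~ 1] is made vertical by filling the open box
   over [f (K (i \/ j, x))] with sides [s f K] and the identity. *)
Lemma fibration_heq_trivial X Y (f : Hom X Y) : fibrant I C X ->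
  fibration I C f -> homotopy_equivalence I f -> trivial_fibration f.
Proof.
move=> fX ff [g [gf /homotopicP [H HH]]].
have [] := fibration_lift_homotopy hC (i := false) (x := g) (k := H) ff.
  by have [-> _] := HH _ (idm Y); cat.
move=> H' [fH' H'0]; pose s := H' ∘ ⟨endpoint I true ∘ bang Y, idm Y⟩.
have fs : f ∘ s = idm Y.
  by rewrite /s comp_assoc fH'; have [_ ->] := HH _ (idm Y); cat.
have /homotopicP [K HK] : homotopic I (s ∘ f) (idm X).
  apply: (homotopic_trans fX _ gf); apply: homotopic_sym => //; apply: homotopic_compr.
  by exists H'; rewrite /at_end H'0 comp_idr.
have K0 S (b : Hom S X) : K ∘ ⟨endpoint I false ∘ bang S, b⟩ = s ∘ (f ∘ b).
  by have [-> _] := HK _ b; cat.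
have K1 S (b : Hom S X) : K ∘ ⟨endpoint I true ∘ bang S, b⟩ = b.
  by have [_ ->] := HK _ b; cat.
have fsx S (b : Hom S Y) : f ∘ (s ∘ b) = b by rewrite comp_assoc fs comp_idl.
have [] := fibration_fill_ends hC (i := false)
  (k := f ∘ (K ∘ ⟨join I ∘ ⟨pr1 ∘ pr2, pr1⟩, pr2 ∘ pr2⟩))
  (x := K) (s := fun e : bool => if e then pr2 else s ∘ (f ∘ K)) ff.
- by cat; rewrite join_0r; cat.
- by case; cat; rewrite ?join_0l ?join_1l ?K1 ?fsx; cat.
- by case; cat; rewrite ?K0 ?K1 ?fsx.
(* [G] is the lid of the box. There [k] takes the value [f (K (t \/ 1, b)) = f b], so [G] is a
   vertical homotopy from [s f] to the identity. *)
move=> d [dk _ ds]; pose G := d ∘ ⟨endpoint I true ∘ bang (I × X), idm (I × X)⟩.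
have fG S (t : Hom S I) (b : Hom S X) : f ∘ (G ∘ ⟨t, b⟩) = f ∘ b.
  by rewrite /G; cat; rewrite (comp_assoc f) dk; cat; rewrite join_1r K1.
have G0 S (b : Hom S X) : G ∘ ⟨endpoint I false ∘ bang S, b⟩ = s ∘ (f ∘ b).
  by rewrite /G; cat; rewrite ds; cat; rewrite K1.
have G1 S (b : Hom S X) : G ∘ ⟨endpoint I true ∘ bang S, b⟩ = b.
  by rewrite /G; cat; rewrite ds; cat.
move=> A B u cu t b e.
(* The candidate [s b] agrees with [t] on [A] only up to [G]; transporting it along [G], over the
   constant path at [b], makes the agreement strict. *)
have [] := fibration_fill hC (i := false) (h := G ∘ ⟨pr1, t ∘ pr2⟩) (x := s ∘ b)
  (k := b ∘ pr2) ff cu.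
- by rewrite fG comp_assoc e; cat.
- by cat; rewrite fsx.
- by cat; rewrite G0 e.
move=> D [D1 D2 D3]; exists (D ∘ ⟨endpoint I true ∘ bang B, idm B⟩); split.
- by cat; rewrite -{1}[u]comp_idr D3; cat; rewrite G1.
- by rewrite comp_assoc D1; cat.
Qed.

(* Dually, [u] is first given a strict retraction [r], and the homotopy
   [K : u r ~ 1] is then made constant on [A]. *)
Lemma cof_heq_rlp_fibration A B X Y (u : Hom A B) (p : Hom X Y) :
  fibrant I C A -> fibrant I C B ->
  C u -> homotopy_equivalence I u -> fibration I C p -> rlp u p.
Proof.
move=> fA fB cu [g [/homotopicP [H HH] ug]] fp.
(* Extend the homotopy [H : g u ~ 1] along [u] to one on [B] starting at [g]; its far end is the
   strict retraction. *)
have [] := fibration_fill hC (p := bang A) (i := false) (h := H) (x := g) (k := bang _) fA cu;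
  try exact: to_one_eq.
  by have [-> _] := HH _ (idm A); cat.
move=> H' [_ H'0 H'u]; pose r := H' ∘ ⟨endpoint I true ∘ bang B, idm B⟩.
have ru : r ∘ u = idm A.
  rewrite /r; cat; rewrite -{1}[u]comp_idr H'u; by have [_ ->] := HH _ (idm A); cat.
have /homotopicP [K HK] : homotopic I (u ∘ r) (idm B).
  apply: (homotopic_trans fB _ ug); apply: homotopic_sym => //; apply: homotopic_compl.
  by exists H'; rewrite /at_end H'0 comp_idr.
have K0 S (b : Hom S B) : K ∘ ⟨endpoint I false ∘ bang S, b⟩ = u ∘ (r ∘ b).
  by have [-> _] := HK _ b; cat.
have K1 S (b : Hom S B) : K ∘ ⟨endpoint I true ∘ bang S, b⟩ = b.
  by have [_ ->] := HK _ b; cat.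
have rux S (b : Hom S A) : r ∘ (u ∘ b) = b by rewrite comp_assoc ru comp_idl.
have [] := fibration_fill_boundary hC (p := bang B) (i := false) (k := bang _) (x := K)
  (s := fun e : bool => if e then pr2 else K ∘ ⟨pr1, u ∘ (r ∘ pr2)⟩)
  (h := K ∘ ⟨join I ∘ ⟨pr1 ∘ pr2, pr1⟩, u ∘ (pr2 ∘ pr2)⟩) fB cu;
  try by move=> *; apply: to_one_eq.
- by case; cat; rewrite ?K0 ?K1; cat; rewrite ?rux.
- by cat; rewrite join_0r.
- by case; cat; rewrite ?join_0l ?join_1l ?K1 ?rux.
(* On the lid the side over [A] becomes [K (t \/ 1, u a) = u a], so [G] is constant there. *)
move=> d [_ _ ds dh]; pose G := d ∘ ⟨endpoint I true ∘ bang (I × B), idm (I × B)⟩.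
have G0 S (b : Hom S B) : G ∘ ⟨endpoint I false ∘ bang S, b⟩ = u ∘ (r ∘ b).
  by rewrite /G; cat; rewrite ds; cat; rewrite K1.
have G1 S (b : Hom S B) : G ∘ ⟨endpoint I true ∘ bang S, b⟩ = b.
  by rewrite /G; cat; rewrite ds; cat.
have Gu S (t : Hom S I) (a : Hom S A) : G ∘ ⟨t, u ∘ a⟩ = u ∘ a.
  by rewrite /G; cat; rewrite dh; cat; rewrite join_1r K1.
move=> t b e.
(* Lift the path [b G] starting from [t r], which lies over [b u r], and keep it constant on [A];
   its far end lies over [b]. *)
have [] := fibration_fill hC (i := false) (h := t ∘ pr2) (x := t ∘ r) (k := b ∘ G) fp cu.
- by rewrite assocr Gu !comp_assoc e.
- by rewrite assocr G0; cat; rewrite !comp_assoc e.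
- by cat; rewrite ru; cat.
move=> D [D1 D2 D3]; exists (D ∘ ⟨endpoint I true ∘ bang B, idm B⟩); split.
- by cat; rewrite -{1}[u]comp_idr D3; cat.
- by rewrite comp_assoc D1; cat; rewrite G1; cat.
Qed.

End Homotopies.

(** * Fibrewise partial map classifiers and the first factorization *)

Section PartialMaps.
Variable E : Topos.
Implicit Types A B S T W X Y Z : E.

Lemma power_ext B X (s s' : Hom B (exp X (Omega E))) :
  (forall S (b : Hom S B) (x : Hom S X),
    ev X (Omega E) ∘ ⟨s ∘ b, x⟩ = top S <-> ev X (Omega E) ∘ ⟨s' ∘ b, x⟩ = top S) ->
  s = s'.
Proof.
move=> H; apply: curry_inj; apply: Omega_ext => S g.
by move: (H S (pr1 ∘ g) (pr2 ∘ g)); cat.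
Qed.

Lemma power_comprehension B X (phi : forall S, Hom S (B × X) -> Prop) :
  representable phi -> exists s : Hom B (exp X (Omega E)),
    forall S (b : Hom S B) (x : Hom S X),
      ev X (Omega E) ∘ ⟨s ∘ b, x⟩ = top S <-> phi S ⟨b, x⟩.
Proof.
move=> [chi Hchi]; case: (curry chi) => s Hs; exists s => S b x.
by rewrite Hs Hchi.
Qed.

Lemma singleton_exists X : exists sg : Hom X (exp X (Omega E)),
  forall S (x y : Hom S X), ev X (Omega E) ∘ ⟨sg ∘ x, y⟩ = top S <-> x = y.
Proof.
case: (power_comprehension (representable_eq (@pr1 _ X X) pr2)) => sg Hsg.
by exists sg => S x y; rewrite Hsg !pr1_pair !pr2_pair.
Qed.

(* [Z] represents the triples [(y, c, s)] of an element [y] of [Y], a truth value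
   [c] in [T1], and a subset [s] of the fibre of [f] over [y] which is empty
   outside [c] and a singleton on [c]: the partial elements of that fibre with
   domain [c]. *)
Lemma partial_element_object X Y (f : Hom X Y) T0 T1 (t : Hom T0 T1)
    (sg : Hom X (exp X (Omega E))) :
  monic t ->
  (forall S (x y : Hom S X), ev X (Omega E) ∘ ⟨sg ∘ x, y⟩ = top S <-> x = y) ->
  exists Z (y : Hom Z Y) (c : Hom Z T1) (s : Hom Z (exp X (Omega E))),
  [/\ forall S (z : Hom S Z) x, ev X (Omega E) ∘ ⟨s ∘ z, x⟩ = top S ->
        exists e, t ∘ e = c ∘ z,
      forall S (z : Hom S Z), (exists e, t ∘ e = c ∘ z) ->
        exists x, f ∘ x = y ∘ z /\ sg ∘ x = s ∘ z,
      forall S (y' : Hom S Y) (c' : Hom S T1) (s' : Hom S (exp X (Omega E))),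
        (forall S' (g : Hom S' S) x, ev X (Omega E) ∘ ⟨s' ∘ g, x⟩ = top S' ->
          exists e, t ∘ e = c' ∘ g) ->
        (forall S' (g : Hom S' S), (exists e, t ∘ e = c' ∘ g) ->
          exists x, f ∘ x = y' ∘ g /\ sg ∘ x = s' ∘ g) ->
        exists z : Hom S Z, [/\ y ∘ z = y', c ∘ z = c' & s ∘ z = s'] &
      forall S (z z' : Hom S Z), y ∘ z = y ∘ z' -> c ∘ z = c ∘ z' -> s ∘ z = s ∘ z' -> z = z'].
Proof.
move=> mt Hsg.
have msg : monic sg.
  move=> S x x' e; apply/Hsg; rewrite e; exact/Hsg.
have mfs : monic ⟨f, sg⟩ by move=> S x x'; rewrite !pair_comp => /pair_inj [_ /msg].
(* [r1] says that membership in [s] forces [c] to hold; [r2] says that where [c] holds, [y] and [s]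
   are [f x] and the singleton of [x] for some [x]. *)
have r1 := representable_all (representable_imp
  (representable_comp ⟨pr2 ∘ (pr2 ∘ pr1), pr2⟩ (representable_true (ev X (Omega E))))
  (representable_comp (pr1 ∘ (pr2 ∘ @pr1 _ (Y × (T1 × exp X (Omega E))) X)) (representable_monic mt))).
have r2 := representable_imp
  (representable_comp (X := Y × (T1 × exp X (Omega E))) (pr1 ∘ pr2) (representable_monic mt))
  (representable_comp ⟨pr1, pr2 ∘ pr2⟩ (representable_monic mfs)).
case: (representable_and r1 r2) => chi Hchi {r1 r2}.
case: (comprehension chi) => Z [w [mw Hw]].
exists Z, (pr1 ∘ w), (pr1 ∘ (pr2 ∘ w)), (pr2 ∘ (pr2 ∘ w)).
have /Hw/Hchi [w1 w2] : exists g, w ∘ g = w by exists (idm Z); cat.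
split.
- move=> S z x ez; have := w1 S z x S (idm S); cat; apply.
  by move: ez; cat.
- move=> S z [e ez]; have := w2 S z; cat=> H.
  have [] := H; first by exists e; move: ez; cat.
  by move=> x; rewrite pair_comp => /pair_inj [e1 e2]; exists x; cat.
- move=> S y' c' s' H1 H2.
  have [z ez] : exists z, w ∘ z = ⟨y', ⟨c', s'⟩⟩.
    apply/Hw/Hchi; split.
    + by move=> S1 g x S2 g'; cat=> H; move: (H1 S2 (g ∘ g') (x ∘ g')); apply.
    + move=> S1 g [e ee]; have [] := H2 S1 g; first by exists e; rewrite ee; cat.
      by move=> x [e1 e2]; exists x; rewrite pair_comp e1 e2; cat.
  by exists z; rewrite !assocr ez !pr2_pair !pr1_pair.
- move=> S z z'; cat=> e1 e2 e3; apply: mw; apply: pair_ext => //; exact: pair_ext.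
Qed.

Variables (I : Interval E) (C : MorClass E) (hC : cofibration_class I C).

(** [Z] consists of the partial elements of the fibres of [f] with domain in [C], and [u] sends [x]
    to the total one at [x]. The projection to [Y] lifts against a cofibration [v : A -> B] because
    a partial map on [A] is also one on [B], its domain being composed with [v]. *)
Lemma cof_trivial_fibration_factor X Y (f : Hom X Y) :
  exists Z (u : Hom X Z) (p : Hom Z Y), [/\ C u, trivial_fibration C p & p ∘ u = f].
Proof.
case: (dom_terminal (cof_dominance hC)) => T0 [T1 [t [ct ut]]].
have mt := dom_monic (cof_dominance hC) ct.
have pb_intro A B (m : Hom A B) (c : Hom B T1) : monic m ->
    (forall S (b : Hom S B), (exists e, t ∘ e = c ∘ b) <-> exists a, m ∘ a = b) ->
    exists e, is_pullback c t m e.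
  move=> mm H; have [e ee] : exists e, t ∘ e = c ∘ m.
    by apply/H; exists (idm A); rewrite comp_idr.
  exists e; split=> // S a b eab.
  have [g eg] : exists g, m ∘ g = a by apply/H; exists b.
  exists g; split; last by move=> h [eh _]; apply: mm; rewrite eg eh.
  by split=> //; apply: mt; rewrite -eab -eg comp_assoc ee assocr.
have pbk B (c : Hom B T1) : exists A (m : Hom A B), C m /\
    forall S (b : Hom S B), (exists e, t ∘ e = c ∘ b) <-> exists a, m ∘ a = b.
  case: (representable_comp c (representable_monic mt)) => chi Hchi.
  case: (comprehension chi) => A [m [mm Hm]]; exists A, m.
  have H S (b : Hom S B) : (exists e, t ∘ e = c ∘ b) <-> exists a, m ∘ a = b.
    by rewrite -Hm Hchi.
  split=> //; case: (pb_intro _ _ m c mm H) => e pb.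
  exact: (dom_pullback (cof_dominance hC) pb).
(* Elements of [T1] are determined by where they hold: [c] and [c'] give pullback squares on the
   same map in [C], and such squares are unique. *)
have ext B (c c' : Hom B T1) : (forall S (b : Hom S B),
    (exists e, t ∘ e = c ∘ b) <-> exists e, t ∘ e = c' ∘ b) -> c = c'.
  move=> H; case: (pbk B c) => A [m [cm Hm]].
  have mm := dom_monic (cof_dominance hC) cm.
  case: (pb_intro _ _ m c mm Hm) => e pb.
  have [] := pb_intro _ _ m c' mm; first by move=> S b; rewrite -H.
  move=> e' pb'; case: (ut _ _ _ cm) => -[a0 a1] [_ u].
  by case: (u (e, c) pb) => _ <-; case: (u (e', c') pb').
have classif A B (m : Hom A B) : C m -> exists c : Hom B T1,
    forall S (b : Hom S B), (exists e, t ∘ e = c ∘ b) <-> exists a, m ∘ a = b.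
  move=> cm; case: (ut _ _ _ cm) => -[a0 a1] [/= [e u] _]; exists a1 => S b; split.
  - by case=> s es; case: (u S b s (eq_sym es)) => l [[el _] _]; exists l.
  - by case=> a <-; exists (a0 ∘ a); rewrite !comp_assoc e.
case: (singleton_exists X) => sg Hsg.
have msg : monic sg by move=> S x x' e; apply/Hsg; rewrite e; exact/Hsg.
case: (partial_element_object f mt Hsg) => Z [y [c [s [P1 P2 P3 P4]]]].
(* [c1] is the domain that holds everywhere. *)
have [c1 Hc1] : exists c1 : Hom X T1, exists e, t ∘ e = c1.
  have [] := classif X X (idm X).
    by apply: (dom_iso (cof_dominance hC)); exists (idm X); rewrite comp_idl.
  move=> c1 H; exists c1; have := H X (idm X); rewrite comp_idr => -[_]; apply.
  by exists (idm X); rewrite comp_idl.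
case: Hc1 => s1 Hs1.
have [] := P3 X f c1 sg.
- by move=> S g x _; exists (s1 ∘ g); rewrite comp_assoc Hs1.
- by move=> S g _; exists g.
move=> u [yu cu su]; exists Z, u, y; split=> //.
(* [u] is the pullback of [t] along the domain map [c], since a partial element whose domain holds
   is an element. *)
- apply: (dom_pullback (cof_dominance hC) (f := c) (u := t) (q := s1)) => //.
  split; first by rewrite cu Hs1.
  move=> S z e ez; have [] := P2 S z; first by exists e.
  move=> x [fx sx]; have cz : c1 ∘ x = c ∘ z.
    apply: ext => S' b; split=> _.
    + by exists (e ∘ b); rewrite comp_assoc -ez.
    + by exists (s1 ∘ (x ∘ b)); rewrite comp_assoc Hs1 comp_assoc.
  exists x; split.
    split.
    + by apply: P4; rewrite comp_assoc ?yu ?cu ?su.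
    + by apply: mt; rewrite comp_assoc Hs1 cz ez.
  by move=> h [hz _]; apply: msg; rewrite sx -hz comp_assoc su.
- move=> A B v cv a b eab.
  have mv := dom_monic (cof_dominance hC) cv.
  (* [A'] is the domain of the partial element [a], and [x] below is its value there. *)
  case: (pbk A (c ∘ a)) => A' [k [ck Hk]].
  have mk := dom_monic (cof_dominance hC) ck.
  have [x [fx sx]] : exists x, f ∘ x = y ∘ (a ∘ k) /\ sg ∘ x = s ∘ (a ∘ k).
    by apply: P2; rewrite comp_assoc; apply/Hk; exists (idm A'); rewrite comp_idr.
  (* The extension to [B] keeps the domain [A'], now embedded by [v ∘ k]; [s2] is the graph of [x]
     over it. *)
  case: (classif _ _ _ (dom_comp (cof_dominance hC) ck cv)) => c2 Hc2.
  have mvx : monic ⟨v ∘ k, x⟩.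
    by move=> S i j; cat=> /pair_inj [/mv/mk].
  case: (power_comprehension (representable_monic mvx)) => s2 Hs2.
  have [] := P3 B b c2 s2.
  + move=> S g z /Hs2 [a']; cat=> /pair_inj [e1 e2]; apply/Hc2.
    by exists a'; cat.
  + move=> S g /Hc2 [a' ea']; exists (x ∘ a'); split.
      by rewrite comp_assoc fx -ea' comp_assoc eab; cat.
    apply: power_ext => S' h z.
    rewrite !assocr Hs2 Hsg -ea'; split.
    * move=> <-; exists (a' ∘ h); by cat.
    * case=> a''; cat=> /pair_inj [/mv/mk -> <-]; by cat.
  move=> d [yd cd sd]; exists d; split=> //; apply: P4.
  + by rewrite comp_assoc yd eab.
  + rewrite comp_assoc cd; apply: ext => S h; rewrite !assocr Hc2 -(assocr c) Hk.
    split=> -[a'].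
    * by cat=> /mv <-; exists a'.
    * by move=> <-; exists a'; cat.
  + rewrite comp_assoc sd; apply: power_ext => S h z; rewrite !assocr Hs2; split.
    * case=> a'; cat=> /pair_inj [/mv <- <-].
      by rewrite (comp_assoc a) (comp_assoc s) -sx assocr; apply/Hsg.
    * move=> ez; case: (P1 _ _ _ ez) => e; rewrite comp_assoc => ec.
      have [a' ea'] : exists a', k ∘ a' = h by apply/Hk; exists e.
      move: ez; rewrite -ea' (comp_assoc a) (comp_assoc s) -sx assocr => /Hsg <-.
      by exists a'; cat.
Qed.

End PartialMaps.

(** * Mapping path objects and the factorization through a fibration *)

Section MappingPath.
Variables (E : Topos) (I : Interval E) (C : MorClass E) (hC : cofibration_class I C).
Implicit Types A B S X Y P : E.

(* [P] is [X ×_Y Y^I], presented by its universal property. *)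
Lemma mapping_path_object X Y (f : Hom X Y) :
  exists P (q : Hom P X) (l : Hom (I × P) Y),
  [/\ forall S (z : Hom S P), l ∘ ⟨endpoint I false ∘ bang S, z⟩ = f ∘ (q ∘ z),
      forall S (x : Hom S X) (m : Hom (I × S) Y),
        m ∘ ⟨endpoint I false ∘ bang S, idm S⟩ = f ∘ x ->
        exists h : Hom S P, q ∘ h = x /\
          forall S' (t : Hom S' I) (z : Hom S' S), l ∘ ⟨t, h ∘ z⟩ = m ∘ ⟨t, z⟩ &
      forall S (h h' : Hom S P), q ∘ h = q ∘ h' ->
        l ∘ ⟨pr1, h ∘ pr2⟩ = l ∘ ⟨pr1, h' ∘ pr2⟩ -> h = h'].
Proof.
pose a : Hom (X × exp I Y) Y := f ∘ pr1.
pose b : Hom (X × exp I Y) Y := ev I Y ∘ ⟨pr2, endpoint I false ∘ bang _⟩.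
exists (equ a b), (pr1 ∘ equ_map a b), (ev I Y ∘ ⟨pr2 ∘ (equ_map a b ∘ pr2), pr1⟩).
split.
- move=> S z; have /equ_factor : exists k, equ_map a b ∘ k = equ_map a b ∘ z by exists z.
  by rewrite /a /b; cat=> ->.
- move=> S x m em; case: (curryl m) => m' Hm.
  have /equ_factor [h eh] : a ∘ ⟨x, m'⟩ = b ∘ ⟨x, m'⟩.
    by rewrite /a /b; cat; rewrite -[m']comp_idr Hm em.
  exists h; split; first by rewrite assocr eh pr1_pair.
  move=> S' t z; cat; rewrite (comp_assoc (equ_map a b)) eh; cat; exact: Hm.
- move=> S h h' eq el; apply: (equ_monic (f := a) (g := b)); apply: pair_ext.
    by move: eq; cat.
  by apply: curryl_inj; move: el; cat.
Qed.

(** [r] sends [x] to the constant path at [f x], and [p] evaluates a path at its end [1]. *)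
Lemma heq_fibration_factor X Y (f : Hom X Y) : fibrant I C X -> fibrant I C Y ->
  exists P (r : Hom X P) (p : Hom P Y),
    [/\ homotopy_equivalence I r, fibration I C p & p ∘ r = f].
Proof.
move=> fX fY; case: (mapping_path_object f) => P [q [l [l0 ex un]]].
have [] := ex X (idm X) (f ∘ pr2); first by cat.
move=> r [qr lr]; exists P, r, (l ∘ ⟨endpoint I true ∘ bang P, idm P⟩); split.
- exists q; split; first by rewrite qr; apply: homotopic_refl.
  (* [G] contracts paths to their start: its path at time [t'] is [l (t /\ t', z)], constant for
     [t' = 0] and unchanged for [t' = 1]. *)
  have [] := ex (I × P) (q ∘ pr2) (l ∘ ⟨meet I ∘ ⟨pr1, pr1 ∘ pr2⟩, pr2 ∘ pr2⟩).
    by cat; rewrite meet_0l l0.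
  move=> G [qG lG]; exists G; split; apply: un.
  + by rewrite comp_assoc qG comp_assoc qr; cat.
  + cat; rewrite lG lr; cat; rewrite meet_0r l0; by cat.
  + by rewrite comp_assoc qG; cat.
  + cat; rewrite lG; cat; rewrite meet_1r; by cat.
- apply: fibration_intro => i A B u h x k cu eh ex' exh.
  (* The component in [X] is extended first, by fibrancy of [X]; the path component is then filled
     in [Y] relative to it. *)
  have [] := fibration_fill hC (p := bang X) (i := i) (h := q ∘ h) (x := q ∘ x)
    (k := bang _) fX cu; try exact: to_one_eq.
    by rewrite assocr exh comp_assoc.
  move=> xx [_ xx0 xxu].
  have xh S (a : Hom S A) : x ∘ (u ∘ a) = h ∘ ⟨endpoint I i ∘ bang S, a⟩.
    by rewrite comp_assoc exh; cat.
  have ph S (z : Hom S _) : l ∘ ⟨endpoint I true ∘ bang S, h ∘ z⟩ = k ∘ ⟨pr1 ∘ z, u ∘ (pr2 ∘ z)⟩.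
    by move/(f_equal (fun f => f ∘ z)): eh; cat.
  have px S (z : Hom S _) : l ∘ ⟨endpoint I true ∘ bang S, x ∘ z⟩ = k ∘ ⟨endpoint I i ∘ bang S, z⟩.
    by move/(f_equal (fun f => f ∘ z)): ex'; cat.
  (* The second interval is the path parameter: the side is [f xx] at its end [0], the prescribed
     [k] at its end [1], and over [A] the paths of [h]. *)
  have [] := fibration_fill_boundary hC (p := bang Y) (i := i) (k := bang _)
    (x := l ∘ ⟨pr1, x ∘ pr2⟩) (s := fun e : bool => if e then k else f ∘ xx)
    (h := l ∘ ⟨pr1 ∘ pr2, h ∘ ⟨pr1, pr2 ∘ pr2⟩⟩) fY cu;
    try by move=> *; apply: to_one_eq.
  + case; cat.
    * by rewrite -[x]comp_idr px.
    * by rewrite xx0 l0; cat.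
  + by cat; rewrite xh.
  + case; cat.
    * by rewrite -[h]comp_idr ph; cat.
    * by rewrite xxu l0; cat.
  move=> d [_ dx ds dh].
  (* The coordinates are swapped because [ex] expects the path parameter first, while [d] takes the
     filling direction first. *)
  have [] := ex (I × B) xx (d ∘ ⟨pr1 ∘ pr2, ⟨pr1, pr2 ∘ pr2⟩⟩).
    by cat; rewrite ds; cat.
  move=> D [qD lD]; exists D; split.
  + cat; rewrite -[D]comp_idr lD; cat; rewrite ds; by cat.
  + apply: un; first by rewrite comp_assoc qD xx0 comp_idr.
    by cat; rewrite lD; cat; rewrite dx; cat.
  + apply: un; first by rewrite comp_assoc qD xxu; cat.
    by cat; rewrite lD; cat; rewrite dh; cat.
- cat; rewrite -[r]comp_idr lr; by cat.
Qed.

End MappingPath.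

(** * The model structure on the fibrant objects *)

Theorem theorem4p4 (E : Topos) (I : Interval E) (C : MorClass E)
    (hC : cofibration_class I C) :
  @model_structure (@full_subcategory E (fibrant I C))
    (@restrict E (fibrant I C) C)
    (@restrict E (fibrant I C) (fibration I C))
    (@restrict E (fibrant I C) (homotopy_equivalence I)).
Proof.
split; rewrite /retract_closed /restrict /=.
- move=> [X fX] [Y fY] [Z fZ] /= f g; exact: (heq_comp hC).
- move=> [X fX] [Y fY] [Z fZ] /= f g; exact: (heq_left hC).
- move=> [X fX] [Y fY] [Z fZ] /= f g; exact: (heq_right hC).
- move=> [A ?] [B ?] [X ?] [Y ?] /= f g; exact: (cof_retract hC).
- move=> [A ?] [B ?] [X ?] [Y ?] /= f g fg pg i U V u P w cu lw.
  exact: (rlp_retract fg (pg i U V u P w cu lw)).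
- move=> [A ?] [B ?] [X ?] [Y ?] /= f g; exact: heq_retract.
- move=> [A fA] [B fB] [X fX] [Y fY] /= u p cu fp wp.
  exact: (fibration_heq_trivial hC fX fp wp cu).
- move=> [A fA] [B fB] [X fX] [Y fY] /= u p cu wu fp.
  exact: (cof_heq_rlp_fibration hC fA fB cu wu fp).
- move=> [X fX] [Y fY] /= f.
  case: (cof_trivial_fibration_factor hC f) => Z [u [p [cu tp e]]].
  have fp := trivial_fibration_fibration hC tp.
  exists (exist _ Z (fibrant_total fp fY)), u, p; split=> //; split=> //; split=> //.
  exact: (trivial_fibration_heq hC tp).
- move=> [X fX] [Y fY] /= f.
  case: (heq_fibration_factor hC f fX fY) => P [r [p [wr fp epr]]].
  (* The homotopy equivalence [r] is refined to a cofibration [u] followed by a trivial fibration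
     [q]; two out of three makes [u] a homotopy equivalence, and [p ∘ q] is still a fibration. *)
  case: (cof_trivial_fibration_factor hC r) => Z [u [q [cu tq e]]].
  have fq := trivial_fibration_fibration hC tq.
  have fP := fibrant_total fp fY; have fZ := fibrant_total fq fP.
  exists (exist _ Z fZ), u, (p ∘ q); split=> //; split.
    apply: (heq_right hC fX fZ fP (trivial_fibration_heq hC tq)).
    by rewrite e.
  by split; [exact: fibration_comp | rewrite assocr e].
Qed.
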